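(* Let $G$ be a locally compact abelian group acting continuously on a locally compact space $X$, and let $\alpha$ be the induced action of $G$ on $C_0(X)$. If the action is proper then any $f$ in $C_c(X)$ is absolutely continuous, that is, $f$ is $\alpha$-integrable and $f\stackrel{rc}{\sim}g$ for every $\alpha$-integrable $g\in C_0(X)$.
   Context: The action $(t,p)\mapsto tp$ of $G$ on the locally compact (Hausdorff) space $X$ is proper if the map $(t,p)\in G\times X\mapsto(tp,p)\in X\times X$ is proper, i.e. inverse images of compact sets are compact. The induced action on $A=C_0(X)$ is $\alpha_t(f)(p)=f(t^{-1}p)$. $G$ has a fixed Haar measure $dt$ and Pontryagin dual $\widehat G$. Integrability: a function $h:G\to A$ is unconditionally integrable if it is Bochner integrable over every relatively compact (measurable) $K\subseteq G$ and the net $\{\int_K h(t)\,dt\}_K$, indexed by the relatively compact subsets ordered by inclusion, converges in norm; the limit is denoted $\int^u_G h(t)\,dt$. An element $a\in A$ is $\alpha$-integrable if for every $b\in A$ the functions $t\mapsto \alpha_t(a)b$ and $t\mapsto b\,\alpha_t(a)$ are unconditionally integrable. Fourier coefficients: write $\langle x,t\rangle$ for the duality between $x\in\widehat G$ and $t\in G$. For $a$ $\alpha$-integrable and $x\in\widehat G$, $E_x(a)$ is the element of the multiplier algebra $M(A)=C_b(X)$ determined by $E_x(a)b=\int^u_G\langle x,t\rangle\alpha_t(a)b\,dt$ for $b\in A$. Relative continuity: for $\alpha$-integrable $a,b$ write $a\stackrel{rc}{\sim}b$ if $\|E_{xz}(a)E_y(b)-E_x(a)E_{zy}(b)\|\to0$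 as $z\to e$ in $\widehat G$, uniformly in $x,y\in\widehat G$. *)

(* Defs.v *)
From HB Require Import structures.
From mathcomp Require Import all_boot all_order all_algebra.
From mathcomp Require Import complex.
From mathcomp Require Import all_classical all_reals all_analysis.

Set Implicit Arguments.
Unset Strict Implicit.
Unset Printing Implicit Defensive.

Import Order.TTheory GRing.Theory Num.Theory.
Import numFieldNormedType.Exports.

Local Open Scope classical_set_scope.
Local Open Scope ring_scope.
Local Open Scope complex_scope.

(* R[i] with the topology of its modulus; as everywhere in the library the
   norm of a complex normed module takes its (real) values in R[i], and
   [complex.Re `|v|] is the corresponding element of R. *)
HB.instance Definition _ (R : realType) := NormedModule.copy R[i] R[i]^o.

Notation rnorm v := (complex.Re `|v|).

Section rnorm_theory.
Context {R : realType} {V : normedModType R[i]}.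
Implicit Types u v : V.

Lemma rnormE v : (rnorm v)%:C = `|v|.
Proof.
have H (z : R[i]) : 0 <= z -> (complex.Re z)%:C = z.
  by case: z => a b; rewrite lecE /= => /andP[/eqP -> _].
exact: H (normr_ge0 v).
Qed.

Lemma rnorm_ge0 v : 0 <= rnorm v.
Proof. by rewrite -lecR rnormE; exact: normr_ge0. Qed.

Lemma rnorm0 : rnorm (0 : V) = 0.
Proof. by apply: complexI; rewrite rnormE normr0. Qed.

Lemma rnormD u v : rnorm (u + v) <= rnorm u + rnorm v.
Proof. by rewrite -lecR rmorphD /= !rnormE ler_normD. Qed.

Lemma rnormZ (c : R[i]) v : rnorm (c *: v) = rnorm c * rnorm v.
Proof. by apply: complexI; rewrite rmorphM /= !rnormE normrZ. Qed.

End rnorm_theory.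

Section bounded_continuous.
Context (R : realType) (X : topologicalType).

Definition bounded_continuous : {pred X -> R[i]} :=
  [pred f | `[< continuous f /\ exists M : R, forall p, rnorm (f p) <= M >]].

Record Cb := MkCb { cb_fun :> X -> R[i]; cb_funP : cb_fun \in bounded_continuous }.

HB.instance Definition _ := [isSub for cb_fun].
HB.instance Definition _ := [Choice of Cb by <:].

Lemma bounded_continuousP f : reflect
  (continuous f /\ exists M : R, forall p, rnorm (f p) <= M)
  (f \in bounded_continuous).
Proof. by rewrite inE; exact: asboolP. Qed.

Lemma bounded_continuous_subring : subring_closed bounded_continuous.
Proof.
split.
- apply/bounded_continuousP; split; first by move=> p; exact: cvg_cst.
  by exists (rnorm (1 : R[i])).
- move=> f g /bounded_continuousP[cf [M fM]] /bounded_continuousP[cg [N gN]].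
  apply/bounded_continuousP; split; first by move=> p; exact: cvgB (cf p) (cg p).
  exists (M + N) => p; apply: le_trans (rnormD _ _) _.
  by rewrite lerD// normrN.
- move=> f g /bounded_continuousP[cf [M fM]] /bounded_continuousP[cg [N gN]].
  apply/bounded_continuousP; split; first by move=> p; exact: cvgM (cf p) (cg p).
  exists (M * N) => p; rewrite (_ : rnorm _ = rnorm (f p) * rnorm (g p)).
    by rewrite ler_pM ?rnorm_ge0.
  exact: (rnormZ (f p) (g p : R[i]^o)).
Qed.

HB.instance Definition _ :=
  GRing.isSubringClosed.Build (X -> R[i]) bounded_continuous
    bounded_continuous_subring.

Lemma bounded_continuous_scale : GRing.scaler_closed bounded_continuous.
Proof.
move=> c f /bounded_continuousP[cf [M fM]].
apply/bounded_continuousP; split; first by move=> p; exact: cvgZr (cf p).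
exists (rnorm c * M) => p; rewrite (_ : rnorm _ = rnorm c * rnorm (f p)).
  by rewrite ler_wpM2l ?rnorm_ge0.
exact: (rnormZ c (f p : R[i]^o)).
Qed.

HB.instance Definition _ :=
  GRing.isScaleClosed.Build R[i] (X -> R[i]) bounded_continuous
    bounded_continuous_scale.

HB.instance Definition _ := [SubChoice_isSubZmodule of Cb by <:].
HB.instance Definition _ :=
  GRing.SubZmodule_isSubPzRing.Build _ _ Cb (subringClosedP _).
HB.instance Definition _ := GRing.SubPzRing_isSubComPzRing.Build _ _ Cb.
HB.instance Definition _ := [SubZmodule_isSubLmodule of Cb by <:].

Implicit Types f g : Cb.

Definition supnorm (f : Cb) : R := sup (range (fun p => rnorm (f p))).

Lemma supnorm_ub f p : rnorm (f p) <= supnorm f.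
Proof.
case: (bounded_continuousP _ (cb_funP f)) => _ [M fM].
apply: ub_le_sup; last by exists p.
by exists M => _ [q _ <-].
Qed.

Lemma supnorm_le f (M : R) :
  0 <= M -> (forall p, rnorm (f p) <= M) -> supnorm f <= M.
Proof.
move=> M0 fM; rewrite /supnorm; set S := [set _ | _ in _].
have [->|/set0P h] := eqVneq S set0; first by rewrite sup0.
by apply: ge_sup => // _ [q _ <-].
Qed.

Lemma supnorm_ge0 f : 0 <= supnorm f.
Proof.
have [[p _]|h] := pselect (exists p : X, True).
  by apply: le_trans (rnorm_ge0 _) (supnorm_ub f p).
rewrite /supnorm; set S := [set _ | _ in _].
suff -> : S = set0 by rewrite sup0.
by rewrite -subset0 => q [p _ _]; apply: h; exists p.
Qed.

Lemma supnormD f g : (supnorm (f + g))%:C <= (supnorm f)%:C + (supnorm g)%:C.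
Proof.
rewrite -rmorphD lecR; apply: supnorm_le => [|p].
  by rewrite addr_ge0 ?supnorm_ge0.
apply: le_trans (rnormD (f p) (g p)) _.
by rewrite lerD ?supnorm_ub.
Qed.

Lemma supnormZ (c : R[i]) f : (supnorm (c *: f))%:C = `|c| * (supnorm f)%:C.
Proof.
have le c' g : supnorm (c' *: g) <= rnorm c' * supnorm g.
  apply: supnorm_le => [|p]; first by rewrite mulr_ge0 ?supnorm_ge0 ?rnorm_ge0.
  rewrite (_ : rnorm _ = rnorm c' * rnorm (g p)).
    by rewrite ler_wpM2l ?rnorm_ge0 ?supnorm_ub.
  exact: (rnormZ c' (g p : R[i]^o)).
rewrite -rnormE -rmorphM; congr (_%:C); apply/eqP; rewrite eq_le le /=.
have [->|c0] := eqVneq c 0.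
  by have /= -> := @rnorm0 R R[i]; rewrite mul0r supnorm_ge0.
have /(ler_wpM2l (rnorm_ge0 c)) := le c^-1 (c *: f).
rewrite scalerA mulVf // scale1r mulrA.
rewrite -(_ : rnorm (c * c^-1) = rnorm c * rnorm c^-1); last first.
  exact: (rnormZ c (c^-1 : R[i]^o)).
by rewrite divff // normr1 mul1r.
Qed.

Lemma supnorm_eq0 f : (supnorm f)%:C = 0 -> f = 0.
Proof.
move=> /(congr1 (@complex.Re R)) /= f0; apply/val_inj/funext => p /=.
apply/eqP; rewrite -normr_eq0 -rnormE; apply/eqP.
have := supnorm_ub f p; rewrite f0 => h.
by congr (_%:C); apply/eqP; rewrite eq_le h rnorm_ge0.
Qed.

HB.instance Definition _ :=
  Lmodule_isNormed.Build R[i] Cb supnormD supnormZ supnorm_eq0.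

Definition vanishing : {pred Cb} :=
  [pred f : Cb | `[< forall e : R, 0 < e -> exists2 K : set X, compact K &
                 forall p, ~ K p -> rnorm (f p) < e >]].

Record C0 := MkC0 { c0_val :> Cb; c0_valP : c0_val \in vanishing }.

HB.instance Definition _ := [isSub for c0_val].
HB.instance Definition _ := [Choice of C0 by <:].

Lemma vanishingP (f : Cb) : reflect
  (forall e : R, 0 < e -> exists2 K : set X, compact K &
     forall p, ~ K p -> rnorm (f p) < e)
  (f \in vanishing).
Proof. by rewrite inE; exact: asboolP. Qed.

(* C_0(X) is an ideal of C_b(X). *)
Lemma vanishingM (m f : Cb) : f \in vanishing -> m * f \in vanishing.
Proof.
move=> /vanishingP f0; apply/vanishingP => e e0.
have M0 : 0 < supnorm m + 1 by rewrite ltr_wpDl ?supnorm_ge0.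
have [K cK Kf] := f0 (e / (supnorm m + 1)) (divr_gt0 e0 M0).
exists K => // p /Kf fp; rewrite (_ : rnorm _ = rnorm (m p) * rnorm (f p)).
  rewrite ltr_pdivlMr // in fp.
  apply: le_lt_trans fp; rewrite mulrC ler_wpM2l ?rnorm_ge0 //.
  by rewrite (le_trans (supnorm_ub m p)) // lerDl.
exact: (rnormZ (m p) (f p : R[i]^o)).
Qed.

Lemma vanishing_submod : submod_closed vanishing.
Proof.
split.
  apply/vanishingP => e e0; exists set0; first exact: compact0.
  by move=> p _; have /= -> := @rnorm0 R R[i].
move=> c f g f0 g0.
have /vanishingP cf0 : (c *: (f : Cb) : Cb) \in vanishing.
  have -> : c *: (f : Cb) = (c *: (1 : Cb) : Cb) * (f : Cb) :> Cb.
    apply/val_inj/funext => p; change (c * f p = c * 1 * f p).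
    by rewrite mulr1.
  exact: vanishingM.
move/vanishingP : g0 => g0.
apply/vanishingP => e e0.
have e20 : 0 < e / 2 by rewrite divr_gt0.
have [K cK Kf] := cf0 _ e20; have [L cL Lg] := g0 _ e20.
exists (K `|` L); first exact: compactU.
move=> p /not_orP[/Kf fp /Lg gp]; apply: le_lt_trans (rnormD _ _) _.
by rewrite (splitr e) ltrD.
Qed.

HB.instance Definition _ :=
  GRing.isSubmodClosed.Build R[i] Cb vanishing vanishing_submod.
HB.instance Definition _ := [SubChoice_isSubLmodule of C0 by <:].

Lemma c0_normD (f g : C0) : `|c0_val (f + g)| <= `|c0_val f| + `|c0_val g|.
Proof. exact: ler_normD. Qed.

Lemma c0_normZ (c : R[i]) (f : C0) : `|c0_val (c *: f)| = `|c| * `|c0_val f|.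
Proof. exact: normrZ. Qed.

Lemma c0_norm_eq0 (f : C0) : `|c0_val f| = 0 -> f = 0.
Proof. by move=> /normr0_eq0 f0; exact/val_inj. Qed.

HB.instance Definition _ :=
  Lmodule_isNormed.Build R[i] C0 c0_normD c0_normZ c0_norm_eq0.

(* M(C_0(X)) is C_b(X), acting on its ideal C_0(X) by multiplication. *)
Definition mulC0 (m : Cb) (b : C0) : C0 := MkC0 (vanishingM m (c0_valP b)).

Definition compact_support (f : C0) := compact (closure [set p | f p != 0]).

End bounded_continuous.

Section group_measure.
Context (R : realType) (G : topologicalZmodType).

(* Groups are abelian and written additively. *)
Definition borel : Type := G.
HB.instance Definition _ := Choice.on borel.
HB.instance Definition _ := isPointed.Build borel (0 : G).
HB.instance Definition _ := Measurable.copy borel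
  (g_sigma_algebraType (@open G : set (set borel))).

(* Nonzero translation-invariant Radon measure; G need not be sigma-compact. *)
Record haar_measure (mu : {measure set borel -> \bar R}) : Prop := HaarMeasure {
  haar_neq0 : mu setT != 0%E ;
  haar_compact : forall K : set G, compact K -> (mu K < +oo)%E ;
  haar_invariant : forall (t : G) (B : set borel), measurable B ->
    mu [set t + s | s in (B : set G)] = mu B ;
  haar_outer : forall B : set borel, measurable B ->
    mu B = ereal_inf [set mu U | U in [set U : set G | open U /\ B `<=` U]] ;
  haar_inner : forall U : set G, open U ->
    mu U = ereal_sup [set mu K | K in [set K : set G | compact K /\ K `<=` U]]
}.

End group_measure.

Section bochner.
Context (R : realType) (d : measure_display) (T : measurableType d).
Context (mu : {measure set T -> \bar R}) (V : normedModType R[i]).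
Implicit Types (K : set T) (h : T -> V).

Definition integrable_simple K (s : T -> V) :=
  [/\ finite_set (range s),
      forall v, measurable (s @^-1` [set v]) &
      forall v, v != 0 -> (mu (K `&` s @^-1` [set v]) < +oo)%E].

(* [fine] only truncates the measure of the fibre of v = 0. *)
Definition simple_integral K (s : T -> V) : V :=
  \sum_(v \in range s) (fine (mu (K `&` s @^-1` [set v])))%:C *: v.

Definition strongly_measurable K h := exists2 s : (T -> V)^nat,
  forall n, integrable_simple K (s n) &
  {ae mu, forall t, K t -> s n t @[n --> \oo] --> h t}.

Definition bochner_approx K h (s : (T -> V)^nat) :=
  (forall n, integrable_simple K (s n)) /\
  (\int[mu]_(t in K) (rnorm (h t - s n t))%:E)%E @[n --> \oo] --> 0%E.

Definition bochner_integrable K h :=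
  strongly_measurable K h /\ exists s, bochner_approx K h s.

(* The common limit of the integrals of all approximating sequences; it exists
   when h is Bochner integrable over K and V is complete. *)
Definition bochner_integral K h : V := xget 0
  [set v | exists2 s, bochner_approx K h s &
                      simple_integral K (s n) @[n --> \oo] --> v].

End bochner.

Section unconditional.
Context (R : realType) (G : topologicalZmodType).
Context (mu : {measure set (borel G) -> \bar R}) (V : normedModType R[i]).
Implicit Types h : G -> V.

Definition relatively_compact : set (set (borel G)) :=
  [set K : set (borel G) | measurable K /\ precompact (K : set G)].

(* The filter of tails of the family of relatively compact sets, directed by
   inclusion: a map has limit v along it iff the net it defines has limit v. *)
Definition relatively_compact_net : set_system (set (borel G)) :=
  filter_from relatively_compact
    (fun K => [set L | relatively_compact L /\ K `<=` L]).

Definition unconditionally_integrable h :=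
  (forall K, relatively_compact K -> bochner_integrable mu K h) /\
  cvg (bochner_integral mu K h @[K --> relatively_compact_net]).

Definition unconditional_integral h : V :=
  lim (bochner_integral mu K h @[K --> relatively_compact_net]).

End unconditional.

Section dual.
Context (R : realType) (G : topologicalZmodType).

Definition character : set {compact-open, G -> R[i]} :=
  [set x : G -> R[i] | [/\ continuous x, forall t, `|x t| = 1 &
                           forall s t, x (s + t) = x s * x t]].

(* The Pontryagin dual, with the subspace topology of the compact-open one; its
   group law is pointwise multiplication. *)
Definition dual : Type := character.
HB.instance Definition _ := Topological.copy dual (character : Type).

Definition pairing (x : dual) : G -> R[i] := val x.

Lemma pairingP (x : dual) : character (pairing x).
Proof. exact: set_valP. Qed.

Lemma character1 : character (cst 1).
Proof.
split => [p|t|s t]; [exact: cvg_cst|exact: normr1|].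
by rewrite mulr1.
Qed.

Lemma characterM (x y : dual) :
  character (fun t => pairing x t * pairing y t).
Proof.
have [cx nx hx] := pairingP x; have [cy ny hy] := pairingP y.
split => [p|t|s t]; first exact: cvgM (cx p) (cy p).
- by rewrite normrM nx ny mulr1.
- by rewrite hx hy mulrACA.
Qed.

Definition mk_dual (x : G -> R[i]) (xP : character x) : dual :=
  exist _ (x : {compact-open, G -> R[i]}) (mem_set xP).

Definition dual1 : dual := mk_dual character1.
Definition dualM (x y : dual) : dual := mk_dual (characterM x y).

End dual.

Section action.
Context (G : topologicalZmodType) (X : topologicalType).

Record continuous_action := ContinuousAction {
  act :> G -> X -> X ;
  act0 : forall p, act 0 p = p ;
  actD : forall s t p, act (s + t) p = act s (act t p) ;
  act_continuous : continuous (fun tp : G * X => act tp.1 tp.2)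
}.

Definition proper_action (theta : continuous_action) :=
  forall K : set (X * X), compact K ->
    compact ((fun tp : G * X => (theta tp.1 tp.2, tp.2)) @^-1` K).

End action.

Section induced_action.
Context (R : realType) (G : topologicalZmodType) (X : topologicalType).
Context (theta : continuous_action G X).

Lemma act_continuous_right t : continuous (theta t).
Proof.
move=> p; apply: (@continuous_comp _ _ _ (fun q => (t, q))
  (fun tp : G * X => theta tp.1 tp.2)); last exact: act_continuous.
by apply: cvg_pair => /=; [exact: cvg_cst|exact: cvg_id].
Qed.

Lemma alpha_bounded_continuous t (f : Cb R X) :
  (fun p => f (theta (- t) p)) \in @bounded_continuous R X.
Proof.
have /bounded_continuousP[cf [M fM]] := cb_funP f.
apply/bounded_continuousP; split; last by exists M => p; exact: fM.
move=> p; apply: (@continuous_comp _ _ _ (theta (- t)) f); last exact: cf.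
exact: act_continuous_right.
Qed.

Lemma alpha_vanishing t (f : C0 R X) :
  MkCb (alpha_bounded_continuous t f) \in @vanishing R X.
Proof.
have /vanishingP f0 := c0_valP f.
apply/vanishingP => e /f0[K cK Kf]; exists (theta t @` K).
  apply: continuous_compact => //; apply: continuous_subspaceT.
  exact: act_continuous_right.
move=> p tKp /=; apply: Kf => Kp; apply: tKp; exists (theta (- t) p) => //.
by rewrite -actD subrr act0.
Qed.

Definition alpha (t : G) (f : C0 R X) : C0 R X := MkC0 (alpha_vanishing t f).

End induced_action.

Section relative_continuity.
Context (R : realType) (G : topologicalZmodType) (X : topologicalType).
Context (mu : {measure set (borel G) -> \bar R}) (theta : continuous_action G X).
Implicit Types a b : C0 R X.

Definition alpha_integrable a := forall b,
  unconditionally_integrable mu (fun t => mulC0 (alpha theta t a) b) /\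
  unconditionally_integrable mu (fun t => mulC0 b (alpha theta t a)).

(* E_x(a), the unique m in C_b(X) with the displayed property (uniqueness as X
   is locally compact Hausdorff). *)
Definition fourier_coefficient (x : dual R G) a : Cb R X := xget 0
  [set m | forall b,
     let h t := pairing x t *: mulC0 (alpha theta t a) b in
     unconditionally_integrable mu h /\ mulC0 m b = unconditional_integral mu h].

Local Notation E := fourier_coefficient.

(* Meant for alpha-integrable a and b. *)
Definition relatively_continuous a b := forall e : R, 0 < e ->
  \forall z \near dual1 R G, forall x y : dual R G,
    rnorm (E (dualM x z) a * E y b - E x a * E (dualM z y) b) < e.

Definition absolutely_continuous a := alpha_integrable a /\
  forall b, alpha_integrable b -> relatively_continuous a b.

End relative_continuity.

(* Main.v *)
(** All functions t |-> x(t) alpha_t(a) b are norm continuous, so their Bochner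
    integrals over relatively compact sets are computed pointwise on X, and
    such a function h is unconditionally integrable exactly when the integrals
    of |h(t)(p)| over M are small, uniformly in p, for M disjoint from a large
    relatively compact set: over the parts of M where Re h or Im h has constant
    sign the norm of the integral controls the integral of the norm.  This
    criterion ignores the unimodular factor x, so E_x(a) exists for every
    alpha-integrable a, with E_x(a)(p) a limit of integrals of x(t) a(-t p);
    on compact sets it is bounded and E_xz(a) -> E_x(a) as z -> 1, uniformly in x.

    For f in C_c(X) with support S, properness makes {t | t S meets C} compact
    for C compact, and translation invariance bounds the integral of |f(-t p)|
    independently of p, so f is alpha-integrable.  Since
    E_x(a)(s p) = x(s) E_x(a)(p), the function
    |E_xz(f) E_y(g) - E_x(f) E_zy(g)| is constant on orbits, and it vanishes
    on the orbits that miss S; it suffices to estimate it on the compact set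
    S, where equicontinuity at z = 1 concludes. *)
From HB Require Import structures.
Require Import Defs.
From mathcomp Require Import all_boot all_order all_algebra.
From mathcomp Require Import complex.
From mathcomp Require Import all_classical all_reals all_analysis.
From mathcomp Require Import ring lra.
From mathcomp Require Import measurable_realfun.

Set Implicit Arguments.
Unset Strict Implicit.
Unset Printing Implicit Defensive.

Import Order.TTheory GRing.Theory Num.Theory.
Import numFieldNormedType.Exports.

Local Open Scope classical_set_scope.
Local Open Scope ring_scope.
Local Open Scope complex_scope.

(** * Complex scalars and the real-valued norm *)

Section scalars.
Context {R : realType}.
Implicit Types z w : R[i].

Lemma rnormE_sqrt z : rnorm z = Num.sqrt (complex.Re z ^+ 2 + complex.Im z ^+ 2).
Proof. by case: z. Qed.

Lemma rnormM z w : rnorm (z * w) = rnorm z * rnorm w.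
Proof. exact: (rnormZ z (w : R[i]^o)). Qed.

Lemma rnorm_real (r : R) : rnorm (r%:C) = `|r|.
Proof. by rewrite rnormE_sqrt /= expr0n addr0 sqrtr_sqr. Qed.

Lemma normr_Re_le z : `|complex.Re z| <= rnorm z.
Proof. by rewrite rnormE_sqrt -sqrtr_sqr ler_wsqrtr// lerDl sqr_ge0. Qed.

Lemma normr_Im_le z : `|complex.Im z| <= rnorm z.
Proof. by rewrite rnormE_sqrt -sqrtr_sqr ler_wsqrtr// lerDr sqr_ge0. Qed.

Lemma rnorm_le_ReIm z : rnorm z <= `|complex.Re z| + `|complex.Im z|.
Proof.
rewrite rnormE_sqrt -[leRHS]ger0_norm ?addr_ge0// -sqrtr_sqr ler_wsqrtr//.
rewrite -(real_normK (num_real (complex.Re z))) -(real_normK (num_real (complex.Im z))).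
have := mulr_ge0 (normr_ge0 (complex.Re z)) (normr_ge0 (complex.Im z)); nra.
Qed.

Lemma complex_ext z w : complex.Re z = complex.Re w ->
  complex.Im z = complex.Im w -> z = w.
Proof. by case: z w => [a b] [c d] /= -> ->. Qed.

End scalars.

Section rnorm_topology.
Context {R : realType} {V : normedModType R[i]}.
Implicit Types u v : V.

Lemma rnormN v : rnorm (- v) = rnorm v.
Proof. by rewrite normrN. Qed.

Lemma rnorm_distC u v : rnorm (u - v) = rnorm (v - u).
Proof. by rewrite distrC. Qed.

Lemma rnormB_le u v : rnorm (u - v) <= rnorm u + rnorm v.
Proof. by rewrite (le_trans (rnormD _ _))// rnormN. Qed.

Lemma rnorm_dist_le u v : `|rnorm u - rnorm v| <= rnorm (u - v).
Proof.
have h (a b : V) : rnorm a - rnorm b <= rnorm (a - b).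
  by rewrite lerBlDr (le_trans _ (rnormD _ _))// subrK.
by rewrite ler_norml h andbT lerNl opprB rnorm_distC h.
Qed.

Lemma rnorm_eq0 v : rnorm v = 0 -> v = 0.
Proof. by move=> v0; apply/normr0_eq0; rewrite -rnormE v0. Qed.

(** A radius in [R[i]] is positive only if its imaginary part is zero, so testing with real radii
    loses nothing. *)
Lemma cvg_rnormP (F : set_system V) {FF : Filter F} v :
  F --> v <-> forall e : R, 0 < e -> \forall w \near F, rnorm (v - w) < e.
Proof.
split=> [/cvgrPdist_lt h e e0|h].
  have e0' : 0 < e%:C by rewrite ltcR.
  by apply: filterS (h _ e0') => w; rewrite -rnormE ltcR.
apply/cvgrPdist_lt => e; case: e => a b; rewrite ltcE/= => /andP[/eqP -> a0].
by apply: filterS (h _ a0) => w; rewrite -rnormE ltcR.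
Qed.

Lemma rnorm_ball u (e : R) v : ball u e%:C v = (rnorm (u - v) < e) :> Prop.
Proof. by rewrite -ball_normE /ball_/= -rnormE ltcR. Qed.

Lemma nbhs_rnormP v (A : set V) :
  nbhs v A <-> exists2 e : R, 0 < e & forall w, rnorm (v - w) < e -> A w.
Proof.
split.
  move/nbhs_ballP => [e /= + h]; case: e h => a b h.
  rewrite ltcE/= => /andP[/eqP b0 a0]; exists a => // w.
  by rewrite -(rnorm_ball v a w) /real_complex_def -b0 => /h.
move=> [e e0 h]; apply/nbhs_ballP; exists e%:C => /=; first by rewrite ltcR.
by move=> w; rewrite rnorm_ball => /h.
Qed.

Lemma continuous_rnormP (T : topologicalType) (h : T -> V) :
  continuous h <-> forall t (e : R), 0 < e ->
    \forall s \near t, rnorm (h t - h s) < e.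
Proof.
split=> [ch t e e0|H t]; last by apply/cvg_rnormP => e /(H t).
by move/cvg_rnormP : (ch t) => /(_ _ e0).
Qed.

Lemma continuous_rnorm_comp (T : topologicalType) (h : T -> V) :
  continuous h -> continuous (fun t => rnorm (h t) : R).
Proof.
move=> /continuous_rnormP ch t; apply/cvgrPdist_lt => e e0.
by apply: filterS (ch t e e0) => s; exact/le_lt_trans/rnorm_dist_le.
Qed.

End rnorm_topology.

Section scalar_continuity.
Context {R : realType} {T : topologicalType}.
Implicit Types u v : T -> R[i].

Lemma continuous_Re u : continuous u -> continuous (fun t => complex.Re (u t)).
Proof.
move=> /continuous_rnormP cu t; apply/cvgrPdist_lt => e e0.
apply: filterS (cu t e e0) => s; rewrite -raddfB.
exact/le_lt_trans/normr_Re_le.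
Qed.

Lemma continuous_Im u : continuous u -> continuous (fun t => complex.Im (u t)).
Proof.
move=> /continuous_rnormP cu t; apply/cvgrPdist_lt => e e0.
apply: filterS (cu t e e0) => s; rewrite -raddfB.
exact/le_lt_trans/normr_Im_le.
Qed.

Lemma continuous_real_complex (r : T -> R) :
  continuous r -> continuous (fun t => (r t)%:C : R[i]).
Proof.
move=> cr; apply/continuous_rnormP => t e e0.
move/cvgrPdist_lt : (cr t) => /(_ _ e0); apply: filterS => s.
by rewrite -rmorphB rnorm_real.
Qed.

Lemma continuousMc u v : continuous u -> continuous v ->
  continuous (fun t => u t * v t).
Proof. by move=> cu cv t; exact: cvgM (cu t) (cv t). Qed.

End scalar_continuity.

(** * Integration against Haar measure *)

Section borel_theory.
Context {R : realType} {G : topologicalZmodType}.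
Implicit Types (u : G -> R) (D : set (borel G)).

Lemma open_measurable_borel (U : set G) : open U -> measurable (U : set (borel G)).
Proof. by move=> oU; exact: sub_sigma_algebra. Qed.

Lemma closed_measurable_borel (F : set G) : closed F -> measurable (F : set (borel G)).
Proof.
move=> cF; rewrite -(setCK F); apply: (@measurableC _ (borel G)).
by apply: open_measurable_borel; exact: closed_openC.
Qed.

Lemma continuous_measurable_borel D u : continuous u ->
  measurable_fun D (u : borel G -> R).
Proof.
move=> /continuousP cu; apply: measurable_funTS.
apply: (measurability _ (RGenOpens.measurableE R)).
move=> _ [_ [a [b ->] <-]]; rewrite setTI.
by apply: open_measurable_borel; apply: cu; exact: interval_open.
Qed.

Lemma continuous_measurable_fun_borel (v : G -> G) : continuous v ->
  measurable_fun setT (v : borel G -> borel G).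
Proof.
move=> /continuousP cv; apply: (@measurability _ _ (borel G) (borel G) setT v open) => //.
by move=> _ [U oU <-]; rewrite setTI; apply: open_measurable_borel; exact: cv.
Qed.

Lemma shift_continuous (s : G) : continuous (fun t : G => t + s).
Proof.
move=> t; apply: (@continuous_comp _ _ _ (fun t => (t, s)) (fun x : G * G => x.1 + x.2)).
  by apply: cvg_pair => /=; [exact: cvg_id|exact: cvg_cst].
exact: add_continuous.
Qed.

Lemma compact_rc (C : set G) : hausdorff_space G -> compact C -> relatively_compact C.
Proof.
move=> hG cC; split; first by apply: closed_measurable_borel; exact: compact_closed.
exact: compact_precompact.
Qed.

Lemma rc_setU (K L : set (borel G)) :
  relatively_compact K -> relatively_compact L -> relatively_compact (K `|` L).
Proof.
move=> [mK pK] [mL pL]; split; first exact: measurableU.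
by move: pK pL; rewrite !precompactE closureU => *; exact: compactU.
Qed.

Lemma rc_subset (K L : set (borel G)) : measurable K -> K `<=` L ->
  relatively_compact L -> relatively_compact K.
Proof. by move=> mK KL [mL pL]; split => //; exact: precompact_subset pL. Qed.

Lemma rc_setD (K L : set (borel G)) :
  relatively_compact K -> relatively_compact L -> relatively_compact (K `\` L).
Proof.
move=> rK rL; apply: rc_subset (rK); last exact: subDsetl.
by apply: measurableD; [case: rK|case: rL].
Qed.

Lemma rc0 : relatively_compact (set0 : set (borel G)).
Proof. by split => //; rewrite precompactE closure0; exact: compact0. Qed.

(** The shifted set lies in the preimage of [closure K] under the translation. This preimage is
    closed, and it is compact as the image of [closure K] under the inverse translation. *)
Lemma rc_shift (K : set (borel G)) (s : G) : relatively_compact K ->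
  relatively_compact [set t | K ((t : G) + s)].
Proof.
move=> [mK pK]; split.
  rewrite -[X in measurable X]setTI.
  exact: (continuous_measurable_fun_borel (@shift_continuous s)).
rewrite precompactE; move: pK; rewrite precompactE => pK.
apply: (@subclosed_compact _ _ ((fun t => t - s) @` closure (K : set G))).
- exact: closed_closure.
- apply: continuous_compact pK; apply: continuous_subspaceT.
  exact: shift_continuous.
- have -> : (fun t => t - s) @` closure (K : set G) =
      (fun t => t + s) @^-1` closure (K : set G).
    apply/seteqP; split=> [_ [t Kt <-]/=|t /= Kt]; first by rewrite subrK.
    by exists (t + s) => //; rewrite addrK.
  have cl : closed ((fun t : G => t + s) @^-1` closure (K : set G)).
    apply: closed_comp; last exact: closed_closure.
    by move=> t _; exact: shift_continuous.
  rewrite [X in _ `<=` X](iffLR (closure_id _) cl).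
  by apply: closureS => t /=; exact: subset_closure.
Qed.

Lemma compact_has_ub u (C : set G) : compact C -> continuous u ->
  exists M, forall t, C t -> `|u t| <= M.
Proof.
move=> cC cu; have cuC : compact (u @` C).
  by apply: continuous_compact => //; exact: continuous_subspaceT.
have [M [Mr HM]] := compact_bounded cuC.
exists (M + 1) => t Ct; apply: (HM (M + 1)); first by rewrite ltrDl.
by exists t.
Qed.

Lemma rc_has_ub u (K : set (borel G)) : relatively_compact K -> continuous u ->
  exists M, forall t, K t -> `|u t| <= M.
Proof.
move=> [_ pK] cu; rewrite precompactE in pK.
have [M HM] := compact_has_ub pK cu.
by exists M => t Kt; apply: HM; exact: subset_closure.
Qed.

End borel_theory.

(** * Scalar integrals over relatively compact sets *)

Section haar_integral.
Context {R : realType} {G : topologicalZmodType}.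
Context (mu : {measure set (borel G) -> \bar R}) (haar : haar_measure mu).
Implicit Types (K L M : set (borel G)) (u : G -> R) (phi psi : G -> R[i]).

Lemma rc_fin K : relatively_compact K -> (mu K < +oo)%E.
Proof.
move=> [mK pK]; rewrite precompactE in pK.
apply: le_lt_trans (haar_compact haar pK).
apply: le_measure; rewrite ?inE//; last exact: subset_closure.
by apply: closed_measurable_borel; exact: closed_closure.
Qed.

Lemma rc_integrable K u : relatively_compact K -> continuous u ->
  mu.-integrable K (EFin \o (u : borel G -> R)).
Proof.
move=> rK cu; have [M HM] := rc_has_ub rK cu.
apply: measurable_bounded_integrable.
- by case: rK.
- exact: rc_fin.
- exact: continuous_measurable_borel.
- exists M; split; first exact: num_real.
  by move=> x Mx y Ky; rewrite /= (le_trans (HM _ Ky))// ltW.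
Qed.

Lemma haar_shift K (s : G) : measurable K -> mu [set t | K ((t : G) + s)] = mu K.
Proof.
move=> mK; rewrite -(haar_invariant haar (- s) mK); congr (mu _).
apply/seteqP; split=> [t /= Kt|_ [t Kt <-]]/=.
  by exists (t + s) => //; rewrite addrC addrK.
by rewrite addrC addrA subrr add0r.
Qed.

Lemma Rintegral_shift K (s : G) u : relatively_compact K -> continuous u ->
  \int[mu]_(t in [set t | K ((t : G) + s)]) u ((t : G) + s) = \int[mu]_(t in K) u t.
Proof.
move=> rK cu; rewrite /Rintegral; congr fine.
pose phi : borel G -> borel G := fun t : G => t + s.
have mphi : measurable_fun setT phi.
  exact: (continuous_measurable_fun_borel (@shift_continuous _ s)).
(* Change of variables: the left side is an integral against the pushforward of [mu] under
   translation, and invariance identifies that measure with [mu] on Borel sets. *)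
transitivity (\int[pushforward mu phi]_(y in K) ((EFin \o (u : borel G -> R)) y))%E.
  rewrite (integral_pushforward mphi)//.
  - by apply/measurable_EFinP; exact: continuous_measurable_borel.
  - apply: (@rc_integrable _ (fun t => u (t + s))); first exact: rc_shift.
    by move=> t; apply: (@continuous_comp _ _ _ (fun t => t + s) u);
      [exact: shift_continuous|exact: cu].
  - by case: rK.
pose mfun_phi : {mfun borel G >-> borel G} :=
  HB.pack phi (isMeasurableFun.Build _ _ _ _ _ mphi).
apply: (@eq_measure_integral _ _ _ _ mu (pushforward mu mfun_phi)) => A mA AK.
exact: haar_shift.
Qed.

(** Complex integral taken by parts; it will turn out to be the value at a point of the Bochner
    integrals in [C0 R X]. *)
Definition cint K phi : R[i] :=
  (\int[mu]_(t in K) complex.Re (phi t)) +i* (\int[mu]_(t in K) complex.Im (phi t)).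

Let Rei K phi : relatively_compact K -> continuous phi ->
  mu.-integrable K (EFin \o ((fun t => complex.Re (phi t)) : borel G -> R)).
Proof. by move=> rK cphi; apply: rc_integrable => //; exact: continuous_Re. Qed.

Let Imi K phi : relatively_compact K -> continuous phi ->
  mu.-integrable K (EFin \o ((fun t => complex.Im (phi t)) : borel G -> R)).
Proof. by move=> rK cphi; apply: rc_integrable => //; exact: continuous_Im. Qed.

Lemma rc_integrable_rnorm K (V : normedModType R[i]) (h : G -> V) :
  relatively_compact K -> continuous h ->
  mu.-integrable K (EFin \o ((fun t => rnorm (h t)) : borel G -> R)).
Proof. by move=> rK ch; apply: rc_integrable => //; exact: continuous_rnorm_comp. Qed.

Lemma cintZ K phi (c : R[i]) : relatively_compact K -> continuous phi ->
  cint K (fun t => c * phi t) = c * cint K phi.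
Proof.
move=> rK cphi; have mK : measurable K by case: rK.
have Z r v : mu.-integrable K (EFin \o (v : borel G -> R)) ->
    mu.-integrable K (EFin \o ((fun t => r * v t) : borel G -> R)).
  by move=> vi; exact: (integrableZl mK r vi).
apply: complex_ext; rewrite /cint/=.
  transitivity (\int[mu]_(t in K) (complex.Re c * complex.Re (phi t) -
    complex.Im c * complex.Im (phi t))).
    by apply: eq_Rintegral => t _; case: c; case: (phi t).
  rewrite RintegralB ?RintegralZl//; [by case: c|exact: Imi|exact: Rei|..].
  - by apply: Z; exact: Rei.
  - by apply: Z; exact: Imi.
transitivity (\int[mu]_(t in K) (complex.Re c * complex.Im (phi t) +
  complex.Im c * complex.Re (phi t))).
  apply: eq_Rintegral => t _; case: c; case: (phi t) => a b c d/=.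
  by rewrite [d * a]mulrC.
rewrite RintegralD ?RintegralZl//; [by case: c|exact: Rei|exact: Imi|..].
- by apply: Z; exact: Imi.
- by apply: Z; exact: Rei.
Qed.

Lemma cintB K phi psi : relatively_compact K -> continuous phi -> continuous psi ->
  cint K (fun t => phi t - psi t) = cint K phi - cint K psi.
Proof.
move=> rK cphi cpsi; have mK : measurable K by case: rK.
apply: complex_ext; rewrite /cint raddfB/= -RintegralB//; try by [exact: Rei|exact: Imi].
- by apply: eq_Rintegral => t _; rewrite raddfB.
- by apply: eq_Rintegral => t _; rewrite raddfB.
Qed.

Lemma cintU K L phi : relatively_compact K -> relatively_compact L ->
  K `&` L = set0 -> continuous phi ->
  cint (K `|` L) phi = cint K phi + cint L phi.
Proof.
move=> rK rL KL cphi; have mK : measurable K by case: rK.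
have mL : measurable L by case: rL.
have rKL := rc_setU rK rL.
have dKL : [disjoint K & L] by apply/disj_setPS; rewrite KL.
apply: complex_ext; rewrite /cint raddfD/= Rintegral_setU//; first exact: Rei.
exact: Imi.
Qed.

Lemma cint_set0 phi : cint set0 phi = 0.
Proof. by rewrite /cint !Rintegral_set0. Qed.

Lemma cint_cst K (c : R[i]) : measurable K -> cint K (fun=> c) = (fine (mu K))%:C * c.
Proof.
move=> mK; rewrite /cint !Rintegral_cst//; case: c => a b.
by apply: complex_ext => /=; rewrite mul0r ?subr0 ?addr0 mulrC.
Qed.

Lemma cint_shift K (s : G) phi : relatively_compact K -> continuous phi ->
  cint [set t | K ((t : G) + s)] (fun t => phi (t + s)) = cint K phi.
Proof.
move=> rK cphi; congr (_ +i* _).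
  by rewrite (@Rintegral_shift _ s (fun t => complex.Re (phi t)))//; exact: continuous_Re.
by rewrite (@Rintegral_shift _ s (fun t => complex.Im (phi t)))//; exact: continuous_Im.
Qed.

(** The factor 2 comes from bounding the real and the imaginary part separately by the integral of
    the modulus. *)
Lemma rnorm_cint_le K phi : relatively_compact K -> continuous phi ->
  rnorm (cint K phi) <= 2 * \int[mu]_(t in K) rnorm (phi t).
Proof.
move=> rK cphi; have mK : measurable K by case: rK.
have iN := rc_integrable_rnorm rK cphi.
rewrite (le_trans (rnorm_le_ReIm _))//= mulr2n mulrDl !mul1r lerD//.
  rewrite (le_trans (le_normr_Rintegral _ (Rei rK cphi)))// le_Rintegral//.
    exact/integrable_norm/Rei.
  by move=> t _; exact: normr_Re_le.
rewrite (le_trans (le_normr_Rintegral _ (Imi rK cphi)))// le_Rintegral//.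
  exact/integrable_norm/Imi.
by move=> t _; exact: normr_Im_le.
Qed.

(** Split [M] into the part where [u] is nonnegative and the rest: on each piece the integral of the
    absolute value is, up to sign, an integral of [u] over a subset of [M]. *)
Lemma Rintegral_norm_le_of_subsets M u (e : R) : relatively_compact M ->
  continuous u ->
  (forall N, relatively_compact N -> N `<=` M -> `|\int[mu]_(t in N) u t| <= e) ->
  \int[mu]_(t in M) `|u t| <= 2 * e.
Proof.
move=> rM cu H; have mM : measurable M by case: rM.
pose P : set (borel G) := M `&` [set t | 0 <= u t].
have mP : measurable P.
  apply: measurableI => //; apply: closed_measurable_borel.
  have -> : [set t | 0 <= u t] = u @^-1` [set x | 0 <= x] by [].
  apply: closed_comp; last exact: closed_ge.
  by move=> x _; exact: cu.
have PM : P `<=` M by exact: subIsetl.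
have rP : relatively_compact P by exact: rc_subset rM.
have rN : relatively_compact (M `\` P) by exact: rc_setD.
have -> : M = P `|` (M `\` P) by rewrite setDUK.
have cnu : continuous (fun t => `|u t|).
  by move=> t; apply: cvg_norm; exact: cu.
rewrite Rintegral_setU//; last 3 first.
- by case: rN.
- by rewrite setDUK//; exact: rc_integrable.
- by apply/disj_setPS; rewrite setDE => t [? [_]].
rewrite mulr2n mulrDl !mul1r lerD//.
  rewrite (@eq_Rintegral _ _ _ _ _ (u : borel G -> R)).
    exact: le_trans (ler_norm _) (H _ rP PM).
  by move=> t /set_mem[_ /= u0]; rewrite ger0_norm.
rewrite (@eq_Rintegral _ _ _ _ _ ((fun t => -1 * u t) : borel G -> R)).
  rewrite RintegralZl//; [|by case: rN|exact: rc_integrable].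
  by rewrite mulN1r (le_trans (ler_norm _))// normrN H.
move=> t /set_mem[Mt Pt]; rewrite mulN1r ler0_norm// leNgt; apply/negP => u0.
by apply: Pt; split => //; exact: ltW.
Qed.

(* The real and imaginary parts have constant sign on suitable measurable
   pieces of M, so small integrals over subsets force a small L1 norm. *)
Lemma Rintegral_rnorm_le_of_subsets M phi (e : R) : relatively_compact M ->
  continuous phi ->
  (forall N, relatively_compact N -> N `<=` M -> rnorm (cint N phi) <= e) ->
  \int[mu]_(t in M) rnorm (phi t) <= 4 * e.
Proof.
move=> rM cphi H; have mM : measurable M by case: rM.
have cRe := continuous_Re cphi; have cIm := continuous_Im cphi.
have cnu u : continuous u -> continuous (fun t : G => `|u t|).
  by move=> cu t; apply: cvg_norm; exact: cu.
have h1 : \int[mu]_(t in M) `|complex.Re (phi t)| <= 2 * e.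
  apply: Rintegral_norm_le_of_subsets => // N rN NM.
  exact: le_trans (normr_Re_le _) (H _ rN NM).
have h2 : \int[mu]_(t in M) `|complex.Im (phi t)| <= 2 * e.
  apply: Rintegral_norm_le_of_subsets => // N rN NM.
  exact: le_trans (normr_Im_le _) (H _ rN NM).
have iR := rc_integrable rM (cnu _ cRe); have iI := rc_integrable rM (cnu _ cIm).
apply: (@le_trans _ _ (\int[mu]_(t in M) (`|complex.Re (phi t)| + `|complex.Im (phi t)|))).
  apply: le_Rintegral => //; first exact: rc_integrable_rnorm.
    exact: integrableD iR iI.
  by move=> t _; exact: rnorm_le_ReIm.
rewrite RintegralD//; lra.
Qed.

Lemma le_Rintegral_rc K u v : relatively_compact K -> continuous u ->
  continuous v -> (forall t, K t -> u t <= v t) ->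
  \int[mu]_(t in K) u t <= \int[mu]_(t in K) v t.
Proof.
by move=> rK cu cv uv; apply: le_Rintegral => //;
  [case: rK|exact: rc_integrable|exact: rc_integrable].
Qed.

Lemma Rintegral_le_measure K u (c : R) : relatively_compact K -> continuous u ->
  (forall t, K t -> u t <= c) -> \int[mu]_(t in K) u t <= c * fine (mu K).
Proof.
move=> rK cu uc; rewrite -Rintegral_cst; last by case: rK.
by apply: (@le_Rintegral_rc K u (fun=> c)) => // t; exact: cvg_cst.
Qed.

End haar_integral.

(** * The space C_0(X) and the induced action *)

Section C0_theory.
Context {R : realType} {X : topologicalType}.
Implicit Types (f g : C0 R X) (p : X).

Lemma c0_rnorm_ub f p : rnorm (f p) <= rnorm f.
Proof. exact: supnorm_ub. Qed.

Lemma c0_rnorm_le f (M : R) :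
  0 <= M -> (forall p, rnorm (f p) <= M) -> rnorm f <= M.
Proof. exact: supnorm_le. Qed.

Lemma c0_subE f g p : (f - g) p = f p - g p.
Proof. by []. Qed.

Lemma c0_scaleE (c : R[i]) f p : (c *: f) p = c * f p.
Proof. by []. Qed.

Lemma c0_continuous f : continuous f.
Proof. by case: (bounded_continuousP _ (cb_funP f)). Qed.

Lemma c0_ext f g : f =1 g -> f = g.
Proof. by move=> fg; apply/val_inj/val_inj/funext. Qed.

(** Three-term estimate for continuity, and an approximant's compact set for vanishing at infinity.
    The lemma turns functions known only by a pointwise formula into elements of [C0 R X]. *)
Lemma c0_uniform_limit (phi : X -> R[i]) :
  (forall e : R, 0 < e -> exists f, forall p, rnorm (phi p - f p) <= e) ->
  exists f, f =1 phi.
Proof.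
move=> H; have bc : phi \in @bounded_continuous R X.
  apply/bounded_continuousP; split.
    apply/continuous_rnormP => p e e0.
    have e40 : 0 < e / 4 by rewrite divr_gt0.
    have [f Hf] := H _ e40.
    have /continuous_rnormP/(_ p _ e40) := @c0_continuous f.
    apply: filterS => q fpq.
    have -> : phi p - phi q = (phi p - f p) + (f p - f q) + (f q - phi q).
      by rewrite (addrA _ (f p)) subrK addrA subrK.
    rewrite (le_lt_trans (rnormD _ _))//.
    have := rnormD (phi p - f p) (f p - f q); have := Hf p; have := Hf q.
    rewrite (rnorm_distC (phi q)) => *; lra.
  have [f Hf] := H 1 ltr01; exists (1 + rnorm f) => p.
  rewrite -(subrK (f p) (phi p)) (le_trans (rnormD _ _))// lerD//.
  exact: c0_rnorm_ub.
have va : MkCb bc \in @vanishing R X.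
  apply/vanishingP => e e0; have e20 : 0 < e / 2 by rewrite divr_gt0.
  have [f Hf] := H _ e20; have /vanishingP/(_ _ e20)[K cK HK] := c0_valP f.
  exists K => // p /HK fp; change (rnorm (phi p) < e).
  rewrite -(subrK (f p) (phi p)).
  by rewrite (le_lt_trans (rnormD _ _))// (splitr e) ler_ltD.
by exists (MkC0 va).
Qed.

(** Completeness of [C0 R X] for arbitrary filters: completeness of the reals gives pointwise limits
    of real and imaginary parts, the Cauchy bound survives in the limit because it is a closed
    condition, and so the limit is uniform. *)
Lemma c0_cauchy_cvg (F : set_system (C0 R X)) : ProperFilter F ->
  (forall e : R, 0 < e -> exists f, \forall g \near F, rnorm (f - g) <= e) ->
  cvg F.
Proof.
move=> PF H.
have ev (u : R[i] -> R) p : (forall z w, u (z - w) = u z - u w) ->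
    (forall z, `|u z| <= rnorm z) -> cvg ((fun g : C0 R X => u (g p)) @ F).
  move=> uB ule; apply/cauchy_cvgP/cauchy_exP => e e0.
  have e20 : 0 < e / 2 by rewrite divr_gt0.
  have [f Hf] := H _ e20; exists (u (f p)).
  apply: filterS Hf => g fg; rewrite /ball/= -uB.
  rewrite (le_lt_trans (ule _))// (@le_lt_trans _ _ (e / 2))//; last by lra.
  by rewrite (le_trans _ fg)// -c0_subE c0_rnorm_ub.
pose phi p : R[i] := lim ((fun g : C0 R X => complex.Re (g p)) @ F) +i*
  lim ((fun g : C0 R X => complex.Im (g p)) @ F).
(* One [e] for the real part and one for the imaginary part. *)
have phiE (e : R) f p : (\forall g \near F, rnorm (f - g) <= e) ->
    rnorm (phi p - f p) <= e + e.
  move=> Hf.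
  have lim_le (u : R[i] -> R) : (forall z w, u (z - w) = u z - u w) ->
      (forall z, `|u z| <= rnorm z) ->
      `|lim ((fun g : C0 R X => u (g p)) @ F) - u (f p)| <= e.
    move=> uB ule; have cu := ev u p uB ule.
    have cB : (fun g : C0 R X => `|u (g p) - u (f p)|) @ F -->
        `|lim ((fun g : C0 R X => u (g p)) @ F) - u (f p)|.
      by apply: cvg_norm; apply: cvgB => //; exact: cvg_cst.
    apply: (closed_cvg (fun x : R => x <= e) _ _ _ cB); first exact: closed_le.
    apply: filterS Hf => g fg; rewrite distrC -uB (le_trans (ule _))//.
    by rewrite (le_trans _ fg)// -c0_subE c0_rnorm_ub.
  rewrite (le_trans (rnorm_le_ReIm _))// lerD// raddfB.
    by apply: lim_le => [z w|]; [exact: raddfB|exact: normr_Re_le].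
  by apply: lim_le => [z w|]; [exact: raddfB|exact: normr_Im_le].
have [h hphi] : exists h : C0 R X, h =1 phi.
  apply: c0_uniform_limit => e e0; have e20 : 0 < e / 2 by rewrite divr_gt0.
  have [f Hf] := H _ e20; exists f => p.
  by rewrite (le_trans (phiE _ _ _ Hf))// -splitr.
apply/cvg_ex; exists h; apply/cvg_rnormP => e e0.
have e40 : 0 < e / 4 by rewrite divr_gt0.
have [f Hf] := H _ e40; apply: filterS (Hf) => g fg.
have hf : rnorm (h - f) <= e / 4 + e / 4.
  apply: c0_rnorm_le => [|p]; first by lra.
  by rewrite c0_subE hphi; exact: phiE.
rewrite -(subrK f h) -addrA (le_lt_trans (rnormD _ _))//; lra.
Qed.

Lemma mulC0E (m : Cb R X) f p : mulC0 m f p = m p * f p.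
Proof. by []. Qed.

(** The one-point compactification is compact Hausdorff, hence normal; Urysohn's lemma separates the
    point at infinity from [K]. Being 0 at infinity and continuous there means vanishing at infinity
    on [X]. *)
Lemma c0_bump (K : set X) : hausdorff_space X -> locally_compact [set: X] ->
  compact K -> exists f, (forall p, K p -> f p = 1) /\
    forall p, exists r : R, 0 <= r <= 1 /\ f p = r%:C.
Proof.
move=> hX lcX cK; pose opc := one_point_compactification X.
have hO : hausdorff_space opc by exact: one_point_compactification_hausdorff.
have nO : normal_space opc.
  by apply: compact_normal => //; exact: one_point_compactification_compact.
have clK : closed (Some @` K : set opc).
  apply: compact_closed => //; apply: continuous_compact => //.
  apply: continuous_subspaceT.
  exact: one_point_compactification_some_continuous.
have clN : closed [set None : opc].
  by apply: accessible_closed_set1; exact: hausdorff_accessible.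
have NK : [set None : opc] `&` (Some @` K) = set0.
  by apply/seteqP; split => // _ [-> [p _]].
have /(@uniform_separatorP _ R)[u [cu u01 uN uK]] := normal_uniform_separator nO clN clK NK.
have cv : continuous (fun p : X => (u (Some p : opc))%:C : R[i]).
  apply: continuous_real_complex => p.
  apply: (@continuous_comp _ _ _ (Some : X -> opc) u); last exact: cu.
  exact: one_point_compactification_some_continuous.
have r01 x : 0 <= u x <= 1.
  by have /= := u01 (u x) (ex_intro2 _ _ x I erefl); rewrite in_itv.
have bc : (fun p : X => (u (Some p : opc))%:C) \in @bounded_continuous R X.
  apply/bounded_continuousP; split=> //; exists 1 => p.
  by rewrite rnorm_real; have /andP[? ?] := r01 (Some p); rewrite ger0_norm.
have va : MkCb bc \in @vanishing R X.
  apply/vanishingP => e e0.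
  have : nbhs (None : opc) [set x | `|u None - u x| < e].
    by move/cvgrPdist_lt : (cu None) => /(_ _ e0).
  have uN0 : u None = 0 by apply: uN; exists None.
  move=> [C [cC clC] HC]; exists C => // p Cp.
  have /= := HC (Some p) (or_introl (ex_intro2 _ _ p Cp erefl)).
  by rewrite uN0 sub0r normrN -rnorm_real.
exists (MkC0 va); split => p.
  by move=> Kp; congr (_%:C); apply: uK; exists (Some p) => //; exists p.
by exists (u (Some p)).
Qed.

End C0_theory.

(** * Norm continuity of orbits *)

Section action_continuity.
Context {R : realType} {G : topologicalZmodType} {X : topologicalType}.
Context (theta : continuous_action G X).
Implicit Types a b : C0 R X.

Lemma alphaE t a p : alpha theta t a p = a (theta (- t) p).
Proof. by []. Qed.

(** [a] is small off a compact set [K], and on [K] a tube argument makes the displacement by group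
    elements near 0 uniformly harmless. *)
Lemma alpha_continuous a : continuous (fun t => alpha theta t a).
Proof.
apply/continuous_rnormP => t0 e e0.
have e40 : 0 < e / 4 by rewrite divr_gt0.
have /vanishingP/(_ _ e40)[K cK HK] := c0_valP a.
have tube : \forall s \near (0 : G), forall q, K q ->
    rnorm (a q - a (theta s q)) < e / 4.
  move/compact_near_coveringP : cK => /(_ _ (nbhs (0 : G))
    (fun s q => rnorm (a q - a (theta s q)) < e / 4)); apply => q Kq.
  have c2 : continuous (fun y : X * G => a y.1 - a (theta y.2 y.1)).
    move=> y; apply: cvgB.
      apply: (@continuous_comp _ _ _ fst a); first exact: cvg_fst.
      exact: c0_continuous.
    apply: (@continuous_comp _ _ _ (fun y : X * G => theta y.2 y.1) a).
      apply: (@continuous_comp _ _ _ (fun y : X * G => (y.2, y.1))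
        (fun tp : G * X => theta tp.1 tp.2)); last exact: act_continuous.
      by apply: cvg_pair => /=; [exact: cvg_snd|exact: cvg_fst].
    exact: c0_continuous.
  have /continuous_rnormP/(_ (q, 0) _ e40) := c2.
  rewrite (_ : _ - _ = 0); last by rewrite /= act0 subrr.
  apply: filterS => y.
  by rewrite sub0r rnormN.
have st0 : (fun t => t - t0) t @[t --> t0] --> (0 : G).
  by rewrite -(subrr t0); exact: shift_continuous.
have ts0 : (fun t => t0 - t) t @[t --> t0] --> (0 : G).
  rewrite -(subrr t0); apply: (@continuous_comp _ _ _ (fun t => (t0, t))
    (fun x : G * G => x.1 - x.2)); last exact: sub_continuous.
  by apply: cvg_pair => /=; [exact: cvg_cst|exact: cvg_id].
have n1 := st0 _ tube; have n2 := ts0 _ tube.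
near=> t; apply: (@le_lt_trans _ _ (e / 2)); last by lra.
apply: c0_rnorm_le => [|p]; first by lra.
rewrite c0_subE !alphaE.
have T1 : forall q, K q -> rnorm (a q - a (theta (t - t0) q)) < e / 4 by near: t.
have T2 : forall q, K q -> rnorm (a q - a (theta (t0 - t) q)) < e / 4 by near: t.
(* If one of the two points to compare lies in [K], the tube estimate applies from it, by
   displacement [t0 - t] or [t - t0]. If neither does, both values are below [e / 4]. *)
have [Kq|/HK nq] := pselect (K (theta (- t0) p)).
  have := T2 _ Kq; rewrite -actD addrAC subrr add0r; lra.
have [Kr|/HK nr] := pselect (K (theta (- t) p)).
  have := T1 _ Kr; rewrite -actD addrAC subrr add0r rnorm_distC; lra.
rewrite (le_trans (rnormB_le _ _))//; lra.
Unshelve. all: by end_near. Qed.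

Lemma modulated_orbit_continuous (x : G -> R[i]) a b : continuous x ->
  continuous (fun t => x t *: mulC0 (alpha theta t a) b).
Proof.
move=> cx t; apply: cvgZ; first exact: cx.
apply/cvg_rnormP => e e0; have b0 : 0 < rnorm b + 1 by rewrite ltr_wpDl ?rnorm_ge0.
have /continuous_rnormP/(_ t _ (divr_gt0 e0 b0)) := @alpha_continuous a.
apply: filterS => s; rewrite ltr_pdivlMr// => ts.
apply: le_lt_trans ts; apply: c0_rnorm_le => [|p].
  by rewrite mulr_ge0 ?rnorm_ge0// ltW.
rewrite c0_subE !mulC0E -mulrBl rnormM ler_pM ?rnorm_ge0//.
  by rewrite -[_ - _]/((alpha theta t a - alpha theta s a) p) c0_rnorm_ub.
by rewrite (le_trans (c0_rnorm_ub _ _))// lerDl.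
Qed.

End action_continuity.

(** * Bochner integrals of continuous functions *)

Section simple_approximation.
Context {R : realType} {G : topologicalZmodType} {V : normedModType R[i]}.
Context (mu : {measure set (borel G) -> \bar R}) (haar : haar_measure mu).
Implicit Types (h : G -> V) (K : set (borel G)) (l : seq V).

Lemma compact_finite_net h (C : set G) (e : R) : 0 < e -> continuous h ->
  compact C -> exists l, forall t, C t -> has (fun v => rnorm (h t - v) < e) l.
Proof.
move=> e0 ch /compact_near_coveringP cC.
(* Finite lists directed by inclusion: near each [t], any list containing [h t] works, and
   compactness turns this into a single list for all of [C]. *)
pose F := filter_from [set: seq V] (fun l => [set l' : seq V | {subset l <= l'}]).
have FF : ProperFilter F.
  apply: filter_from_proper; last by move=> l _; exists l.
  apply: filter_from_filter; first by exists [::].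
  move=> l1 l2 _ _; exists (l1 ++ l2) => // l /= H.
  by split => v vl; apply: H; rewrite mem_cat vl ?orbT.
have cover t : C t ->
    \forall t' \near t & l \near F, has (fun v => rnorm (h t' - v) < e) l.
  move=> Ct; exists ([set s | rnorm (h t - h s) < e], [set l : seq V | h t \in l]).
    split; first by move/continuous_rnormP : ch; apply.
    by exists [:: h t] => // l; apply; rewrite inE.
  move=> [s l] /= [hs tl]; apply/hasP; exists (h t) => //.
  by rewrite rnorm_distC.
have [l _ Hl] := cC _ F (fun l t => has (fun v => rnorm (h t - v) < e) l) _ cover.
by exists l => t Ct; exact: Hl.
Qed.

(** The first entry of [l] within [e] of [h t], with default 0, rather than a closest one; this
    makes the fibres Borel by recursion on [l]. *)
Definition nearest h l (e : R) (t : borel G) : V :=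
  foldr (fun v r => if rnorm (h t - v) < e then v else r) 0 l.

Lemma nearest_lt h l e t : has (fun v => rnorm (h t - v) < e) l ->
  rnorm (h t - nearest h l e t) < e.
Proof. by elim: l => //= v l IH; case: ifPn. Qed.

Lemma nearest_range h l e t : nearest h l e t \in 0 :: l.
Proof.
elim: l => [|v l IH] /=; first by rewrite inE.
case: ifPn => _; first by rewrite !inE eqxx orbT.
by move: IH; rewrite !inE => /orP[->//|->]; rewrite !orbT.
Qed.

Lemma nearest_measurable h l e v : continuous h ->
  measurable (nearest h l e @^-1` [set v]).
Proof.
move=> ch; elim: l => [|w l IH].
  have [v0|v0] := eqVneq v 0.
    rewrite (_ : _ @^-1` _ = setT)//.
    by apply/seteqP; split => // t _ /=; rewrite v0.
  rewrite (_ : _ @^-1` _ = set0)//.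
  by apply/seteqP; split => // t /= h0; move: v0; rewrite -h0 eqxx.
pose U : set (borel G) := [set t | rnorm (h t - w) < e].
have mU : measurable U.
  apply: open_measurable_borel.
  have /continuousP cn : continuous (fun t => rnorm (h t - w) : R).
    by apply: continuous_rnorm_comp => t; apply: cvgB; [exact: ch|exact: cvg_cst].
  exact: (cn _ (@open_lt R e)).
rewrite (_ : _ @^-1` _ = (U `&` [set _ | w = v]) `|` (~` U `&` nearest h l e @^-1` [set v])).
  apply: measurableU; apply: measurableI => //; last exact: measurableC.
  have [wv|wv] := pselect (w = v).
    by rewrite (_ : [set _ | _] = setT)//; apply/seteqP; split.
  by rewrite (_ : [set _ | _] = set0)//; apply/seteqP; split.
apply/seteqP; split => t /=; rewrite /U/=.
  by case: ifPn => [lt <-|/negP lt nv]; [left|right].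
by case: ifPn => [lt [[]//|[]//]|lt [[]//|[]//]].
Qed.

Lemma simple_approx h K (e : R) : 0 < e -> continuous h -> relatively_compact K ->
  exists s, integrable_simple mu K s /\ forall t, K t -> rnorm (h t - s t) < e.
Proof.
move=> e0 ch rK; have [mK pK] := rK; rewrite precompactE in pK.
have [l Hl] := compact_finite_net e0 ch pK.
exists (nearest h l e); split; last first.
  by move=> t Kt; apply: nearest_lt; apply: Hl; exact: subset_closure.
split.
- apply: (sub_finite_set _ (finite_seq (0 :: l))) => _ [t _ <-] /=.
  exact: nearest_range.
- by move=> v; exact: nearest_measurable.
- move=> v _; apply: le_lt_trans (rc_fin haar rK).
  apply: le_measure; rewrite ?inE//.
  by apply: measurableI => //; exact: nearest_measurable.
Qed.

Lemma measurable_rnorm_sub_simple h K (s : borel G -> V) D : continuous h ->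
  integrable_simple mu K s ->
  measurable_fun D (fun t : borel G => rnorm (h t - s t) : R).
Proof.
move=> ch [fs ms _]; apply: measurable_funTS => _ B mB; rewrite setTI.
have -> : (fun t : borel G => rnorm (h t - s t) : R) @^-1` B =
    \bigcup_(v in range s) ((s @^-1` [set v]) `&`
      (fun t : borel G => rnorm (h t - v) : R) @^-1` B).
  apply/seteqP; split => [t Bt|t [_ [t' _ <-]] [/= -> //]].
  by exists (s t); [exists t|].
apply: fin_bigcup_measurable => // v _; apply: measurableI => //.
rewrite -[X in measurable X]setTI.
apply: (@continuous_measurable_borel _ _ setT (fun t => rnorm (h t - v))) => //.
by apply: continuous_rnorm_comp => t; apply: cvgB; [exact: ch|exact: cvg_cst].
Qed.

(** Simple functions within [1/(n+1)] of [h] uniformly on [K] have mean error at most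
    [mu K / (n+1)], and [mu K] is finite. *)
Lemma continuous_bochner_integrable h K : continuous h -> relatively_compact K ->
  bochner_integrable mu K h.
Proof.
move=> ch rK; have mK : measurable K by case: rK.
have H n : exists s, integrable_simple mu K s /\
    forall t, K t -> rnorm (h t - s t) < n.+1%:R^-1.
  by apply: simple_approx => //; rewrite invr_gt0.
have [s Hs] := choice H; have s1 n : integrable_simple mu K (s n) by case: (Hs n).
have s2 n t : K t -> rnorm (h t - s n t) < n.+1%:R^-1 by case: (Hs n) => _; exact.
split.
  exists s => //; apply: aeW => t Kt; apply/cvg_rnormP => e e0.
  have := @near_infty_natSinv_lt R (PosNum e0); apply: filterS => n.
  exact: lt_trans (s2 n t Kt).
exists s; split => //.
apply: (@squeeze_cvge _ _ _ _ (fun=> 0%E) _ (fun n => (n.+1%:R^-1)%:E * mu K)%E).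
- apply: nearW => n; apply/andP; split.
    by apply: integral_ge0 => t _; rewrite lee_fin rnorm_ge0.
  rewrite -(integral_cst mu mK); apply: ge0_le_integral => //.
  + by move=> t _; rewrite lee_fin rnorm_ge0.
  + by apply/measurable_EFinP; exact: measurable_rnorm_sub_simple.
  + by move=> t Kt; rewrite /= lee_fin ltW// s2.
- exact: cvg_cst.
- have muK : mu K \is a fin_num by rewrite ge0_fin_numE// rc_fin.
  rewrite -(fineK muK) -[X in _ --> X]/((0:R)%:E).
  under eq_fun do rewrite -EFinM.
  apply: cvg_EFin; first by apply: nearW.
  rewrite -[X in _ --> X](mul0r (fine (mu K))); apply: cvgMl.
  exact: cvg_harmonic.
Qed.

End simple_approximation.

(** * Bochner integrals computed pointwise *)

Section bochner_eval.
Context {R : realType} {G : topologicalZmodType} {X : topologicalType}.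
Context (mu : {measure set (borel G) -> \bar R}) (haar : haar_measure mu).
Implicit Types (h : G -> C0 R X) (K : set (borel G)).

Lemma continuous_eval h p : continuous h -> continuous (fun t => h t p).
Proof.
move=> /continuous_rnormP ch; apply/continuous_rnormP => t e e0.
apply: filterS (ch t e e0) => s; apply: le_lt_trans.
by rewrite -c0_subE c0_rnorm_ub.
Qed.

Lemma bigsetU_rc (I : Type) (r : seq I) (F : I -> set (borel G)) :
  (forall i, relatively_compact (F i)) ->
  relatively_compact (\big[setU/set0]_(i <- r) F i).
Proof.
move=> rF; elim: r => [|i r IH]; first by rewrite big_nil; exact: rc0.
by rewrite big_cons; exact: rc_setU.
Qed.

(** On each piece, the term for [v] is the integral of the constant [v p], so the difference is the
    integral of [h t - v] at [p]. The list formulation allows induction on the pieces. *)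
Lemma rnorm_sum_sub_cint_le h (F : C0 R X -> set (borel G)) (l : seq (C0 R X)) p :
  continuous h -> (forall v, relatively_compact (F v)) -> uniq l ->
  trivIset setT F ->
  rnorm ((\sum_(v <- l) (fine (mu (F v)))%:C *: v) p -
         cint mu (\big[setU/set0]_(v <- l) F v) (fun t => h t p)) <=
  2 * \sum_(v <- l) \int[mu]_(t in F v) rnorm (h t - v).
Proof.
move=> ch rF + tF; have cp := continuous_eval (p:=p) ch.
elim: l => [_|v l IH]; last rewrite cons_uniq => /andP[vl ul].
  rewrite !big_nil cint_set0 mulr0 subr0.
  by rewrite [X in rnorm X](_ : _ = 0)// rnorm0.
rewrite !big_cons cintU//; last 2 first.
- exact: bigsetU_rc.
- rewrite big_distrr/= big1_seq// => w /andP[_ wl].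
  apply/seteqP; split => // t [tv tw].
  have vw : v = w by apply: (tF v w) => //; exists t.
  by move: vl; rewrite vw wl.
have -> (a b : C0 R X) : (a + b) p = a p + b p by [].
rewrite opprD addrACA (le_trans (rnormD _ _))// mulrDr lerD ?IH//.
rewrite c0_scaleE -cint_cst//; last by case: (rF v).
have ccst : continuous (fun _ : G => v p) by move=> t; exact: cvg_cst.
rewrite rnorm_distC.
rewrite -(cintB haar (rF v) cp ccst).
have chv : continuous (fun t => h t - v).
  by move=> t; apply: cvgB; [exact: ch|exact: cvg_cst].
rewrite (le_trans (rnorm_cint_le haar (rF v) (continuous_eval (p:=p) chv)))//.
rewrite ler_wpM2l//; apply: le_Rintegral_rc => //.
- exact/continuous_rnorm_comp/continuous_eval.
- exact: continuous_rnorm_comp.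
- by move=> t _; exact: c0_rnorm_ub.
Qed.

Lemma simple_integral_eval_le h K (s : borel G -> C0 R X) p : continuous h ->
  relatively_compact K -> integrable_simple mu K s ->
  rnorm (simple_integral mu K s p - cint mu K (fun t => h t p)) <=
  2 * fine (\int[mu]_(t in K) (rnorm (h t - s t))%:E)%E.
Proof.
move=> ch rK iS; have [fs ms _] := iS; have mK : measurable K by case: rK.
pose F v := K `&` s @^-1` [set v].
have rF v : relatively_compact (F v).
  by apply: rc_subset (rK); [exact: measurableI|exact: subIsetl].
have tF : trivIset setT F by move=> v w _ _ [t [[_ /= <-] [_ /= <-]]].
set l := finmap.enum_fset (fset_set (range s)).
(* The fibres of [s] over its finitely many values partition [K]. *)
have KE : K = \big[setU/set0]_(v <- l) F v.
  rewrite bigsetU_fset_set//; apply/seteqP; split => [t Kt|t [v _ []//]].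
  by exists (s t).
have ul : uniq l by exact: finmap.fset_uniq.
have -> : (\int[mu]_(t in K) (rnorm (h t - s t))%:E =
    (\sum_(v <- l) \int[mu]_(t in F v) rnorm (h t - v))%:E)%E.
  rewrite [in LHS]KE ge0_integral_bigsetU//=; last 4 first.
  - by move=> v; case: (rF v).
  - exact: sub_trivIset tF.
  - by apply/measurable_EFinP; exact: measurable_rnorm_sub_simple iS.
  - by move=> t _; rewrite lee_fin; exact: supnorm_ge0.
  rewrite -sumEFin; apply: eq_bigr => v _.
  have chv : continuous (fun t => h t - v).
    by move=> t; apply: cvgB; [exact: ch|exact: cvg_cst].
  rewrite /Rintegral fineK.
    by apply: eq_integral => t /set_mem[_ /= ->].
  apply: integrable_fin_num; first by case: (rF v).
  exact: (rc_integrable_rnorm haar (rF v) chv).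
rewrite /= {2}KE /simple_integral fsbig_finite//.
exact: rnorm_sum_sub_cint_le.
Qed.

(** For every approximating sequence the simple integrals converge to the pointwise integral,
    uniformly on [X]. Hence the pointwise integral is an element [w] of [C0 R X] and the norm limit
    of all these sequences. *)
Lemma bochner_integral_eval h K p : continuous h -> relatively_compact K ->
  bochner_integral mu K h p = cint mu K (fun t => h t p).
Proof.
move=> ch rK.
have approx s (e : R) : bochner_approx mu K h s -> 0 < e ->
    \forall n \near \oo, forall q,
      rnorm (simple_integral mu K (s n) q - cint mu K (fun t => h t q)) <= e.
  move=> [iS /fine_cvgP[_ /cvgrPdist_lt H]] e0.
  have e20 : 0 < e / 2 by rewrite divr_gt0.
  apply: filterS (H _ e20) => n; rewrite sub0r normrN => /ltW ne q.
  rewrite (le_trans (simple_integral_eval_le q ch rK (iS n)))//.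
  by rewrite mulrC -ler_pdivlMr// (le_trans (ler_norm _) ne).
have [s sa] : exists s, bochner_approx mu K h s.
  by case: (continuous_bochner_integrable haar ch rK).
have [w Hw] : exists w : C0 R X, w =1 fun q => cint mu K (fun t => h t q).
  apply: c0_uniform_limit => e e0; have [n _ Hn] := approx s e sa e0.
  exists (simple_integral mu K (s n)) => q.
  by rewrite rnorm_distC; exact: (Hn n (leqnn n)).
have cvg_w s' : bochner_approx mu K h s' ->
    simple_integral mu K (s' n) @[n --> \oo] --> w.
  move=> sa'; apply/cvg_rnormP => e e0.
  have e20 : 0 < e / 2 by rewrite divr_gt0.
  apply: filterS (approx s' _ sa' e20) => n Hn.
  apply: (@le_lt_trans _ _ (e / 2)); last by lra.
  apply: c0_rnorm_le => [|q]; first exact: ltW.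
  by rewrite c0_subE Hw rnorm_distC.
rewrite -Hw; congr (c0_val _ p).
(* [w] shows that the set from which [xget] chooses is inhabited, so the default 0 does not occur;
   uniqueness of limits then identifies the choice with [w]. *)
have [s' sa' cs'] : [set v | exists2 s, bochner_approx mu K h s &
    simple_integral mu K (s n) @[n --> \oo] --> v] (bochner_integral mu K h).
  by apply: xgetPex; exists w, s => //; exact: cvg_w.
by apply: (cvg_unique _ cs' (cvg_w s' sa')); exact: norm_hausdorff.
Qed.

End bochner_eval.

(** * Unconditional integrals and the dual group *)

Lemma rnorm_eq_of_le {R : realType} {V : normedModType R[i]} (u v : V) :
  (forall e : R, 0 < e -> rnorm (u - v) <= e) -> u = v.
Proof.
move=> H; apply/eqP; rewrite -subr_eq0; apply/eqP/rnorm_eq0.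
by apply/eqP; rewrite eq_le rnorm_ge0 andbT; apply/ler_addgt0Pl => e /H; rewrite addr0.
Qed.

Section unconditional_theory.
Context {R : realType} {G : topologicalZmodType} {X : topologicalType}.
Context (mu : {measure set (borel G) -> \bar R}) (haar : haar_measure mu).
Implicit Types (h : G -> C0 R X) (K L M : set (borel G)).

#[local] Instance relatively_compact_net_proper :
  ProperFilter (@relatively_compact_net G).
Proof.
apply: filter_from_proper; last by move=> K rK; exists K; split.
apply: filter_from_filter; first by exists set0; exact: rc0.
move=> K L rK rL; exists (K `|` L); first exact: rc_setU.
by move=> M [rM KLM]; split; split => //; apply: subset_trans KLM;
  [exact: subsetUl|exact: subsetUr].
Qed.

(* Absolute form of the Cauchy condition for the net of integrals of h. *)
Definition small_tails h := forall e : R, 0 < e ->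
  exists2 K, relatively_compact K & forall M, relatively_compact M ->
    M `&` K = set0 -> forall p, \int[mu]_(t in M) rnorm (h t p) <= e.

Lemma unconditional_integral_approx h (e : R) : continuous h ->
  unconditionally_integrable mu h -> 0 < e ->
  exists2 K, relatively_compact K & forall L, relatively_compact L -> K `<=` L ->
    forall p, rnorm (unconditional_integral mu h p - cint mu L (fun t => h t p)) <= e.
Proof.
move=> ch [_ ch_lim] e0.
have /cvg_rnormP/(_ e e0)[K rK HK] :
  bochner_integral mu L h @[L --> @relatively_compact_net G] -->
  unconditional_integral mu h by exact: ch_lim.
exists K => // L rL KL p; rewrite -(bochner_integral_eval haar)//.
rewrite -c0_subE (le_trans (c0_rnorm_ub _ _))//; apply/ltW.
exact: (HK L (conj rL KL)).
Qed.

(** For [N] disjoint from [K], the integral over [N] is the difference of those over [K] united with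
    [N] and over [K], both close to the limit. Smallness over all such [N] inside [M] bounds the
    integral of the modulus. *)
Lemma unconditionally_integrable_tails h : continuous h ->
  unconditionally_integrable mu h -> small_tails h.
Proof.
move=> ch ih e e0; have e80 : 0 < e / 8 by rewrite divr_gt0.
have [K rK HK] := unconditional_integral_approx ch ih e80.
exists K => // M rM MK p.
(* Two approximation errors of [e / 8], times the factor 4 lost in passing to the modulus. *)
have -> : e = 4 * (e / 8 + e / 8) by lra.
apply: Rintegral_rnorm_le_of_subsets => //; first exact: continuous_eval.
move=> N rN NM; have cp := continuous_eval (p := p) ch.
have KN : K `&` N = set0.
  by rewrite -subset0 => t [Kt /NM Mt]; rewrite -MK.
have := cintU haar rK rN KN cp.
move=> /(canLR (addKr _)) <-.
set i := unconditional_integral mu h p.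
have -> (a b : R[i]) : - a + b = (i - a) - (i - b).
  by rewrite opprB [RHS]addrC addrA subrK addrC.
rewrite (le_trans (rnormB_le _ _))// lerD//.
  by apply: HK.
by apply: HK; [exact: rc_setU|exact: subsetUl].
Qed.

(** Once [L] contains [K], the integrals over [L] and [K] differ by the one over their set
    difference, which is a tail; so the net is Cauchy and completeness applies. *)
Lemma tails_unconditionally_integrable h : continuous h ->
  small_tails h -> unconditionally_integrable mu h.
Proof.
move=> ch th; split; first by move=> K rK; exact: continuous_bochner_integrable.
apply: c0_cauchy_cvg => e e0.
have e20 : 0 < e / 2 by rewrite divr_gt0.
have [K rK HK] := th _ e20; exists (bochner_integral mu K h).
exists K => // L [rL KL].
change (rnorm (bochner_integral mu K h - bochner_integral mu L h) <= e).
apply: c0_rnorm_le => [|p]; first exact: ltW.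
have cp := continuous_eval (p := p) ch.
rewrite c0_subE [X in rnorm (X - _)](bochner_integral_eval haar p ch rK).
rewrite [X in rnorm (_ - X)](bochner_integral_eval haar p ch rL).
have rLK := rc_setD rL rK.
rewrite -[in cint mu L _](setDUK KL) (cintU haar)//; last by rewrite setDIK.
rewrite opprD addrA subrr add0r rnormN (le_trans (rnorm_cint_le haar _ _))//.
rewrite mulrC -ler_pdivlMr// HK//.
by rewrite setIC setDIK.
Qed.

End unconditional_theory.

(** * Characters near the trivial one *)

Section dual_theory.
Context {R : realType} {G : topologicalZmodType}.
Implicit Types (x y z : dual R G).

Lemma pairing_continuous x : continuous (pairing x).
Proof. by case: (pairingP x). Qed.

Lemma rnorm_pairing x t : rnorm (pairing x t) = 1.
Proof. by case: (pairingP x) => _ -> _. Qed.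

Lemma pairingD x s t : pairing x (s + t) = pairing x s * pairing x t.
Proof. by case: (pairingP x). Qed.

Lemma dualMC x y : dualM x y = dualM y x.
Proof.
by apply: val_inj; apply/funext => t; rewrite /= mulrC.
Qed.

(** The characters sending the compact set [closure K] into a disc about 1 form an open set of the
    compact-open topology. *)
Lemma near_dual1 (K : set (borel G)) (d : R) : relatively_compact K -> 0 < d ->
  \forall z \near dual1 R G, forall t, K t -> rnorm (pairing z t - 1) <= d.
Proof.
move=> [_ pK] d0; rewrite precompactE in pK.
pose O : set R[i] := [set w | rnorm (w - 1) < d].
have oO : open O.
  rewrite openE => w Ow; apply/(@nbhs_rnormP _ R[i]).
  exists (d - rnorm (w - 1)); first by rewrite subr_gt0.
  move=> v wv; rewrite /O/=; apply: le_lt_trans (_ : rnorm (v - w) + rnorm (w - 1) < d).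
    by rewrite -(subrK w v) -addrA addrK; exact: (@rnormD _ R[i]).
  by rewrite (@rnorm_distC _ R[i]) -ltrBrDr.
have W := @compact_open_open G R[i] _ O pK oO.
pose A : set (dual R G) := [set z | (pairing z) @` closure (K : set G) `<=` O].
have oA : open A by exists [set g | g @` closure (K : set G) `<=` O].
have : nbhs (dual1 R G) A.
  apply: open_nbhs_nbhs; split => // _ [t _ <-].
  by change (rnorm (1 - 1 : R[i]) < d); rewrite subrr rnorm0.
apply: filterS => z Az t Kt; apply/ltW/Az.
by exists t => //; exact: subset_closure.
Qed.

End dual_theory.

(** * Fourier coefficients *)

Lemma rnorm_dist_le3 {R : realType} {V : normedModType R[i]} (u u' v' v : V) :
  rnorm (u - v) <= rnorm (u - u') + rnorm (u' - v') + rnorm (v - v').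
Proof.
rewrite (rnorm_distC v).
have -> : u - v = (u - u') + (u' - v') + (v' - v).
  by rewrite (addrA (u - u')) subrK addrA subrK.
by rewrite (le_trans (rnormD _ _))// lerD2r rnormD.
Qed.

Lemma rnorm_cross_le {R : realType} (i j u v w : R[i]) (d : R) :
  rnorm (i - u * w) <= d -> rnorm (j - v * w) <= d ->
  rnorm (i * v - j * u) <= d * (rnorm u + rnorm v).
Proof.
move=> h1 h2.
have -> : i * v - j * u = (i - u * w) * v - (j - v * w) * u by ring.
rewrite (le_trans (rnormB_le _ _))// !rnormM mulrDr [leRHS]addrC.
by rewrite lerD// ler_wpM2r ?rnorm_ge0.
Qed.

Section fourier_theory.
Context {R : realType} {G : topologicalZmodType} {X : topologicalType}.
Context (mu : {measure set (borel G) -> \bar R}) (haar : haar_measure mu).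
Context (hausX : hausdorff_space X) (lcX : locally_compact [set: X]).
Context (theta : continuous_action G X).
Implicit Types (a b : C0 R X) (K L M : set (borel G)) (x y z : dual R G) (p : X).

Definition modulated x a b t := pairing x t *: mulC0 (alpha theta t a) b.

Definition partial_coefficient L x a p : R[i] :=
  cint mu L (fun t => pairing x t * a (theta (- t) p)).

Local Notation I x a b := (unconditional_integral mu (modulated x a b)).
Local Notation c := partial_coefficient.
Local Notation E := (fourier_coefficient mu theta).

Lemma modulatedE x a b t p :
  modulated x a b t p = pairing x t * (a (theta (- t) p) * b p).
Proof. by []. Qed.

Lemma modulated_continuous x a b : continuous (modulated x a b).
Proof. exact/modulated_orbit_continuous/pairing_continuous. Qed.

Lemma mulC0_alpha_continuous a b : continuous (fun t => mulC0 (alpha theta t a) b).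
Proof.
have -> : (fun t => mulC0 (alpha theta t a) b) =
    (fun t => (1 : R[i]) *: mulC0 (alpha theta t a) b).
  by apply/funext => t; rewrite scale1r.
by apply: (@modulated_orbit_continuous _ _ _ _ (fun=> 1)) => t; exact: cvg_cst.
Qed.

Lemma orbit_fun_continuous a p : continuous (fun t : G => a (theta (- t) p)).
Proof. exact: (@continuous_eval _ _ _ (fun t => alpha theta t a) p
  (@alpha_continuous _ _ _ theta a)). Qed.

Lemma coefficient_integrand_continuous x a p :
  continuous (fun t => pairing x t * a (theta (- t) p)).
Proof.
by apply: continuousMc; [exact: pairing_continuous|exact: orbit_fun_continuous].
Qed.

Lemma cint_modulated L x a b p : relatively_compact L ->
  cint mu L (fun t => modulated x a b t p) = b p * c L x a p.
Proof.
move=> rL; rewrite -(cintZ haar _ rL); last exact: coefficient_integrand_continuous.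
congr (cint mu L _); apply/funext => t.
by rewrite modulatedE mulrA mulrC.
Qed.

Lemma modulated_tails x a b : alpha_integrable mu theta a ->
  small_tails mu (modulated x a b).
Proof.
move=> ia e e0; have [ib _] := ia b.
have [K rK HK] := unconditionally_integrable_tails haar
  (@mulC0_alpha_continuous a b) ib e0.
exists K => // M rM MK p; apply: le_trans (HK M rM MK p).
apply: (le_Rintegral_rc haar rM).
- exact/continuous_rnorm_comp/continuous_eval/modulated_continuous.
- exact/continuous_rnorm_comp/continuous_eval/mulC0_alpha_continuous.
- by move=> t _; rewrite modulatedE rnormM rnorm_pairing mul1r.
Qed.

Lemma modulated_integrable x a b : alpha_integrable mu theta a ->
  unconditionally_integrable mu (modulated x a b).
Proof.
move=> ia; apply: tails_unconditionally_integrable => //.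
  exact: modulated_continuous.
exact: modulated_tails.
Qed.

Lemma modulated_integral_approx x a b (e : R) : alpha_integrable mu theta a ->
  0 < e -> exists2 K, relatively_compact K & forall L, relatively_compact L ->
  K `<=` L -> forall p, rnorm (I x a b p - b p * c L x a p) <= e.
Proof.
move=> ia e0; have [K rK HK] := unconditional_integral_approx haar
  (@modulated_continuous x a b) (modulated_integrable x b ia) e0.
by exists K => // L rL KL p; rewrite -cint_modulated//; exact: HK.
Qed.

(** For a common large [L], the two integrals at [p] are close to [b p] and [b' p] times the same
    [c L x a p], so cross multiplication agrees in the limit. *)
Lemma modulated_integralC x a b b' p : alpha_integrable mu theta a ->
  I x a b p * b' p = I x a b' p * b p.
Proof.
move=> ia; apply: rnorm_eq_of_le => e e0.
have N0 : 0 < rnorm (b p) + rnorm (b' p) + 1.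
  by rewrite ltr_wpDl// addr_ge0 ?rnorm_ge0.
pose d := e / (rnorm (b p) + rnorm (b' p) + 1); have d0 : 0 < d by exact: divr_gt0.
have [K rK HK] := modulated_integral_approx x b ia d0.
have [K' rK' HK'] := modulated_integral_approx x b' ia d0.
have rL := rc_setU rK rK'; have h1 := HK _ rL (@subsetUl _ _ _) p.
have h2 := HK' _ rL (@subsetUr _ _ _) p.
apply: le_trans (rnorm_cross_le h1 h2) _.
by rewrite mulrAC ler_pdivrMr// ler_wpM2l ?lerDl// ltW.
Qed.

(** [m p] is the integral at [p] formed with a bump equal to 1 at [p]; the symmetry of
    [modulated_integralC] carries it over to every [b]. *)
Lemma coefficient_factor x a : alpha_integrable mu theta a ->
  exists m : X -> R[i], forall b p, I x a b p = m p * b p.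
Proof.
move=> ia; have H p : exists b : C0 R X, b p = 1.
  by have [b [b1 _]] := c0_bump (R := R) hausX lcX (@compact_set1 _ p); exists b; exact: b1.
have [bump Hbump] := choice H; exists (fun p => I x a (bump p) p) => b p.
by rewrite -modulated_integralC// Hbump mulr1.
Qed.

(** With [b] equal to 1 on a compact neighbourhood of [p], [m] agrees there with a continuous
    function. *)
Lemma coefficient_factor_continuous (m : X -> R[i]) :
  (forall b, exists d : C0 R X, forall p, d p = m p * b p) -> continuous m.
Proof.
move=> H p; have := lcX (Logic.I : [set: X] p).
rewrite withinET => -[C nC [cC clC]].
have [b [b1 _]] := c0_bump (R := R) hausX lcX cC.
have [d Hd] := H b.
have dp : d p = m p by rewrite Hd b1 ?mulr1//; exact: nbhs_singleton nC.
rewrite /continuous_at -dp; apply: cvg_trans (@c0_continuous _ _ d p).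
apply: near_eq_cvg; apply: filterS nC => q Cq.
by rewrite Hd b1 ?mulr1.
Qed.

(* Gliding hump: if m were unbounded, say |m(p_n)| > 4^n, the element
   sum_n 2^-n b_n with bumps b_n(p_n) = 1 would have an unbounded product with m. *)
Lemma coefficient_factor_bounded (m : X -> R[i]) :
  (forall b, exists d : C0 R X, forall p, d p = m p * b p) ->
  exists M : R, forall p, rnorm (m p) <= M.
Proof.
move=> H; apply: contrapT => nb.
have unb n : exists p, 4 ^+ n < rnorm (m p).
  apply: contrapT => hn; apply: nb; exists (4 ^+ n) => p.
  by rewrite leNgt; apply/negP => lt; apply: hn; exists p.
have [q Hq] := choice unb.
have bumps n := c0_bump (R := R) hausX lcX (@compact_set1 _ (q n)).
have [b Hb] := choice bumps.
pose u n : C0 R X := ((2^-1 ^+ n : R)%:C : R[i]) *: b n.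
pose S N : C0 R X := \sum_(n < N) u n.
have half0 n : 0 <= 2^-1 ^+ n :> R by rewrite exprn_ge0.
have rb n p : exists2 r : R, 0 <= r <= 1 & b n p = r%:C.
  by have [_ /(_ p)[r [r01 br]]] := Hb n; exists r.
have un n : rnorm (u n) <= 2^-1 ^+ n.
  rewrite rnormZ rnorm_real ger0_norm// ler_piMr//.
  apply: c0_rnorm_le => // p; have [r /andP[r0 r1] ->] := rb n p.
  by rewrite rnorm_real ger0_norm.
(* Geometric tail in telescoped form, which lets the induction on [j] close. *)
have SS N j : rnorm (S (N + j)%N - S N) <= 2 * 2^-1 ^+ N - 2 * 2^-1 ^+ (N + j).
  elim: j => [|j IH]; first by rewrite addn0 !subrr rnorm0.
  have -> : S (N + j.+1)%N = S (N + j)%N + u (N + j)%N by rewrite addnS /S big_ord_recr.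
  rewrite addnS addrAC (le_trans (rnormD _ _))//.
  have := un (N + j)%N; rewrite exprS; lra.
have cS : cvg (S n @[n --> \oo]).
  apply: c0_cauchy_cvg => e e0.
  have e20 : 0 < e / 2 by rewrite divr_gt0.
  have : (2^-1 ^+ n : R) @[n --> \oo] --> (0 : R).
    by apply: cvg_expr; rewrite ger0_norm// invf_lt1// ltr1n.
  move=> /cvgrPdist_lt/(_ _ e20)[N _ HN]; exists (S N); exists N => // k Nk.
  change (rnorm (S N - S k) <= e); rewrite rnorm_distC -(subnKC Nk) (le_trans (SS _ _))//.
  have := HN N (leqnn N); rewrite /= sub0r normrN ger0_norm//.
  have := half0 (N + (k - N))%N; lra.
pose B : C0 R X := lim (S n @[n --> \oo]).
have SB : S n @[n --> \oo] --> B by exact: cS.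
have ReS N p : complex.Re (S N p) = \sum_(n < N) complex.Re (u n p).
  by apply: (big_morph (fun v : C0 R X => complex.Re (v p))) => // v w; rewrite raddfD.
(* Nonnegative real parts exclude cancellation: at [q n] every partial sum past [n] is at least its
   own term [2^-n]. *)
have Reu n p : 0 <= complex.Re (u n p).
  rewrite c0_scaleE; have [r /andP[r0 _] ->] := rb n p.
  by rewrite -rmorphM/= mulr_ge0.
have Bq n : 2^-1 ^+ n <= complex.Re (B (q n)).
  apply/ler_addgt0Pl => e e0.
  move/cvg_rnormP : SB => /(_ e e0)[N _ HN].
  have BS : rnorm (B - S (N + n.+1)%N) < e by exact: (HN _ (leq_addr _ _)).
  have hS : 2^-1 ^+ n <= complex.Re (S (N + n.+1)%N (q n)).
    have nN : (n < N + n.+1)%N by rewrite addnS ltnS leq_addl.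
    rewrite ReS (bigD1 (Ordinal nN))//; apply: ler_wpDr; first exact: sumr_ge0.
    have [b1 _] := Hb n.
    by rewrite c0_scaleE b1// mulr1.
  move: (S (N + n.+1)%N) hS BS => S' hS BS.
  have : `|complex.Re (B (q n) - S' (q n))| < e.
    apply: le_lt_trans BS; apply: le_trans (normr_Re_le _) _.
    by rewrite -c0_subE c0_rnorm_ub.
  rewrite raddfB ltr_norml => /andP[h _].
  apply: le_trans hS _; move: h.
  by rewrite ltrBrDr addrC ltrBlDr addrC => /ltW.
have [d Hd] := H B.
(* The growth [4^n] of [m] outweighs the weight [2^-n], so the product [d] would have to exceed
   every [2^n]. *)
have dq n : 2 ^+ n <= rnorm d.
  apply: le_trans (c0_rnorm_ub d (q n)); rewrite Hd rnormM.
  have h1 : 2^-1 ^+ n <= rnorm (B (q n)).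
    exact: le_trans (Bq n) (le_trans (ler_norm _) (normr_Re_le _)).
  have -> : (2 : R) ^+ n = 4 ^+ n * 2^-1 ^+ n.
    by rewrite -exprMn; congr (_ ^+ n); lra.
  by apply: ler_pM => //; exact/ltW/Hq.
have [n Hn] : exists n, rnorm d < n%:R :> R.
  by exists (Num.bound (rnorm d)); rewrite archi_boundP// rnorm_ge0.
have n2 : n%:R <= (2 : R) ^+ n.
  by rewrite -[X in X ^+ n]/(2%:R : R) -natrX ler_nat; apply/ltnW/ltn_expl.
by have := lt_le_trans Hn n2; rewrite ltNge dq.
Qed.

(** The factor [m] is continuous and bounded, so a multiplier with the defining property exists and
    [xget] returns one. *)
Lemma fourier_coefficientP x a b : alpha_integrable mu theta a ->
  mulC0 (E x a) b = I x a b.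
Proof.
move=> ia; have [m Hm] := coefficient_factor x ia.
have mb b0 : exists d : C0 R X, forall p, d p = m p * b0 p by exists (I x a b0).
have bc : m \in @bounded_continuous R X.
  apply/bounded_continuousP; split; first exact: coefficient_factor_continuous.
  exact: coefficient_factor_bounded.
suff /(_ b)[] : forall b0, let h t := pairing x t *: mulC0 (alpha theta t a) b0 in
    unconditionally_integrable mu h /\
    mulC0 (E x a) b0 = unconditional_integral mu h by [].
apply: (@xgetPex _ 0 [set m | forall b,
     let h t := pairing x t *: mulC0 (alpha theta t a) b in
     unconditionally_integrable mu h /\ mulC0 m b = unconditional_integral mu h]).
exists (MkCb bc) => b0; split; first exact: modulated_integrable.
by apply: c0_ext => p; rewrite Hm.
Qed.

Lemma fourier_approx x a b (e : R) : alpha_integrable mu theta a -> 0 < e ->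
  exists2 K, relatively_compact K & forall L, relatively_compact L ->
  K `<=` L -> forall p, b p = 1 -> rnorm (E x a p - c L x a p) <= e.
Proof.
move=> ia e0; have [K rK HK] := modulated_integral_approx x b ia e0.
exists K => // L rL KL p bp; have := HK L rL KL p.
by rewrite -fourier_coefficientP// mulC0E bp mulr1 mul1r.
Qed.

(** Substituting [t + s] for [t] undoes the displacement of [p] and splits off the factor
    [pairing x s]. *)
Lemma partial_coefficient_shift L x a p s : relatively_compact L ->
  c L x a (theta s p) = pairing x s * c [set t | L ((t : G) + s)] x a p.
Proof.
move=> rL; have cx := coefficient_integrand_continuous.
rewrite /partial_coefficient -(cint_shift haar s rL (cx x a _)).
rewrite -(cintZ haar _ (rc_shift s rL) (cx x a p)).
congr (cint mu _ _); apply/funext => t.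
by rewrite -actD opprD addrNK pairingD mulrAC mulrC mulrA.
Qed.

Lemma fourier_coefficient_act x a p s : alpha_integrable mu theta a ->
  E x a (theta s p) = pairing x s * E x a p.
Proof.
move=> ia; apply: rnorm_eq_of_le => e e0; have e20 : 0 < e / 2 by rewrite divr_gt0.
have [b [b1 _]] := c0_bump (R := R) hausX lcX
  (compactU (@compact_set1 _ p) (@compact_set1 _ (theta s p))).
have [K rK HK] := fourier_approx x b ia e20.
(* Chosen so that both [L] and its shift by [s] contain [K], which makes the approximation valid at
   [theta s p] and at [p]. *)
pose L := K `|` [set t | K ((t : G) - s)].
have rL : relatively_compact L by apply: rc_setU => //; exact: rc_shift.
have h1 := HK L rL (@subsetUl _ _ _) _ (b1 (theta s p) (or_intror erefl)).
have KL : K `<=` [set t | L ((t : G) + s)].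
  by move=> t Kt; right; rewrite /= addrK.
have h2 := HK _ (rc_shift s rL) KL _ (b1 p (or_introl erefl)).
rewrite partial_coefficient_shift// in h1.
set w := c _ _ _ _ in h1 h2.
have -> : E x a (theta s p) - pairing x s * E x a p =
   (E x a (theta s p) - pairing x s * w) - pairing x s * (E x a p - w) by ring.
rewrite (le_trans (rnormB_le _ _))// rnormM rnorm_pairing mul1r; lra.
Qed.

(** A bump equal to 1 on [C] removes the factor [b] from the tail estimate, uniformly in [p] on
    [C]. *)
Lemma orbit_tails a (C : set X) (e : R) : alpha_integrable mu theta a ->
  compact C -> 0 < e -> exists2 K, relatively_compact K &
  forall M, relatively_compact M -> M `&` K = set0 -> forall p, C p ->
  \int[mu]_(t in M) rnorm (a (theta (- t) p)) <= e.
Proof.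
move=> ia cC e0; have [b [b1 _]] := c0_bump (R := R) hausX lcX cC.
have [ib _] := ia b.
have [K rK HK] := unconditionally_integrable_tails haar
  (@mulC0_alpha_continuous a b) ib e0.
exists K => // M rM MK p Cp; apply: le_trans (HK M rM MK p).
apply: (le_Rintegral_rc haar rM).
- exact/continuous_rnorm_comp/orbit_fun_continuous.
- exact/continuous_rnorm_comp/continuous_eval/mulC0_alpha_continuous.
- by move=> t _; rewrite [X in _ <= rnorm X]mulC0E b1// mulr1.
Qed.

Lemma Rintegral_split (u : G -> R) L K : relatively_compact L ->
  relatively_compact K -> K `<=` L -> continuous u ->
  \int[mu]_(t in L) u t = \int[mu]_(t in K) u t + \int[mu]_(t in L `\` K) u t.
Proof.
move=> rL rK KL cu; rewrite -[in LHS](setDUK KL) Rintegral_setU//.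
- by case: rK.
- by case: (rc_setD rL rK).
- by rewrite setDUK//; exact: rc_integrable.
- by apply/disj_setPS; rewrite setDIK.
Qed.

Lemma fourier_bounded_on_compact a (C : set X) : alpha_integrable mu theta a ->
  compact C -> exists2 B : R, 0 < B & forall x p, C p -> rnorm (E x a p) <= B.
Proof.
move=> ia cC; have [b [b1 _]] := c0_bump (R := R) hausX lcX cC.
have [K0 rK0 HK0] := orbit_tails ia cC ltr01.
have m0 : 0 <= fine (mu K0) by exact: fine_ge0.
have B0 : 0 <= rnorm a * fine (mu K0) by rewrite mulr_ge0 ?rnorm_ge0.
(* The first 1 is the error of truncation; 2 comes from [rnorm_cint_le]; inside, the integral over
   [K0] and a tail of at most 1. [K1] may depend on [x], but [K0] does not, so neither does the
   bound. *)
exists (1 + 2 * (rnorm a * fine (mu K0) + 1)) => [|x p Cp]; first by lra.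
have [K1 rK1 HK1] := fourier_approx x b ia ltr01.
have rL := rc_setU rK0 rK1.
have h1 := HK1 _ rL (@subsetUr _ _ _) p (b1 p Cp).
have h2 := rnorm_cint_le haar rL (coefficient_integrand_continuous (x := x) (a := a) (p := p)).
have co := continuous_rnorm_comp (orbit_fun_continuous (a := a) (p := p)).
rewrite (@eq_Rintegral _ _ _ _ _ ((fun t => rnorm (a (theta (- t) p))) : borel G -> R)) in h2; last first.
  by move=> t _; rewrite rnormM rnorm_pairing mul1r.
rewrite (Rintegral_split rL rK0 (@subsetUl _ _ _) co) in h2.
have h3 := HK0 _ (rc_setD rL rK0) _ p Cp.
have h4 := Rintegral_le_measure haar rK0 co (fun t _ => c0_rnorm_ub a (theta (- t) p)).
rewrite setIC setDIK in h3; have {}h3 := h3 erefl.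
have := rnormD (E x a p - c (K0 `|` K1) x a p) (c (K0 `|` K1) x a p).
rewrite subrK => h5; apply: le_trans h5 _.
by rewrite lerD// (le_trans h2)// ler_wpM2l// lerD.
Qed.

Lemma fourier_equicontinuous_on_compact a (C : set X) (e : R) :
  alpha_integrable mu theta a -> compact C -> 0 < e ->
  \forall z \near dual1 R G, forall x p, C p ->
    rnorm (E (dualM x z) a p - E x a p) <= e.
Proof.
move=> ia cC e0; have [b [b1 _]] := c0_bump (R := R) hausX lcX cC.
(* The budget is [d] for each of two truncations and [2 * (d + 2 * d)] for the difference of the
   truncated integrals. *)
pose d := e / 8; have d0 : 0 < d by rewrite divr_gt0.
have [K0 rK0 HK0] := orbit_tails ia cC d0.
pose A := rnorm a * fine (mu K0).
have A0 : 0 <= A by rewrite mulr_ge0 ?rnorm_ge0 ?fine_ge0.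
have A1 : 0 < A + 1 by rewrite ltr_wpDl.
have dA0 : 0 < d / (A + 1) by rewrite divr_gt0.
have dA : d / (A + 1) * A <= d.
  by rewrite mulrAC ler_pdivrMr// ler_wpM2l ?lerDl// ltW.
(* Only [K0], which is independent of [x], decides how near [z] must be to the trivial character.
   The sets [K1] and [K2] depend on [x] and [z] and merely enlarge the domain, where [K0] already
   controls the tail. *)
apply: filterS (near_dual1 rK0 dA0) => z Hz x p Cp.
have [K1 rK1 HK1] := fourier_approx x b ia d0.
have [K2 rK2 HK2] := fourier_approx (dualM x z) b ia d0.
pose L := K0 `|` (K1 `|` K2).
have rL : relatively_compact L by apply: rc_setU => //; exact: rc_setU.
have L0 : K0 `<=` L by exact: subsetUl.
have h1 := HK1 L rL (subset_trans (@subsetUl _ _ _) (@subsetUr _ _ _)) p (b1 p Cp).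
have h2 := HK2 L rL (subset_trans (@subsetUr _ _ _) (@subsetUr _ _ _)) p (b1 p Cp).
have co := continuous_rnorm_comp (orbit_fun_continuous (a := a) (p := p)).
have cx y := coefficient_integrand_continuous (x := y) (a := a) (p := p).
pose g t := pairing (dualM x z) t * a (theta (- t) p) - pairing x t * a (theta (- t) p).
have cg : continuous g by move=> t; apply: cvgB; exact: cx.
have gE t : rnorm (g t) = rnorm (pairing z t - 1) * rnorm (a (theta (- t) p)).
  rewrite -rnormM -[RHS]mul1r -(rnorm_pairing x t) -rnormM; congr (rnorm _).
  rewrite /g (_ : pairing (dualM x z) t = pairing x t * pairing z t)//; ring.
have h3 : rnorm (c L (dualM x z) a p - c L x a p) <= 2 * \int[mu]_(t in L) rnorm (g t).
  by rewrite -(cintB haar rL (cx _) (cx _)); exact: rnorm_cint_le.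
have cng := continuous_rnorm_comp cg.
rewrite (Rintegral_split rL rK0 L0 cng) in h3.
have h4 : \int[mu]_(t in K0) rnorm (g t) <= d.
  apply: le_trans dA; rewrite /A mulrA.
  apply: (Rintegral_le_measure haar rK0 cng) => t Kt.
  by rewrite gE ler_pM ?rnorm_ge0 ?c0_rnorm_ub ?Hz.
have h5 : \int[mu]_(t in L `\` K0) rnorm (g t) <= 2 * d.
  have rD := rc_setD rL rK0.
  apply: (@le_trans _ _ (\int[mu]_(t in L `\` K0) (2 * rnorm (a (theta (- t) p))))).
    apply: (le_Rintegral_rc haar rD cng).
      by move=> t; apply: cvgM; [exact: cvg_cst|exact: co].
    move=> t _; rewrite gE ler_wpM2r ?rnorm_ge0//.
    rewrite (le_trans (rnormB_le _ _))// rnorm_pairing.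
    by rewrite (rnorm_real 1) normr1.
  rewrite RintegralZl//; [|by case: rD|exact: rc_integrable].
  by rewrite ler_wpM2l// HK0// setIC setDIK.
apply: le_trans (rnorm_dist_le3 _ (c L (dualM x z) a p) (c L x a p) _) _.
have -> : e = d + (2 * (d + 2 * d)) + d by rewrite /d; lra.
rewrite lerD// lerD// (le_trans h3)// ler_wpM2l// lerD//.
Qed.

End fourier_theory.

(** * Compactly supported functions *)

(** Both products carry the same unimodular factor [x * z * y]; what remains is
    [(u' - u) * v - u * (v' - v)]. *)
Lemma rnorm_twisted_cross_le {R : realType} (x y z u u' v v' : R[i]) (d B D r : R) :
  rnorm x = 1 -> rnorm y = 1 -> rnorm z = 1 ->
  rnorm (u' - u) <= d -> rnorm v <= D -> rnorm u <= B -> rnorm (v' - v) <= r ->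
  rnorm (x * z * u' * (y * v) - x * u * (z * y * v')) <= d * D + B * r.
Proof.
move=> x1 y1 z1 h1 h2 h3 h4.
have -> : x * z * u' * (y * v) - x * u * (z * y * v') =
  x * z * y * ((u' - u) * v - u * (v' - v)) by ring.
rewrite !rnormM x1 y1 z1 !mul1r (le_trans (rnormB_le _ _))// !rnormM.
by rewrite lerD// ler_pM ?rnorm_ge0.
Qed.

Section main.
Context {R : realType} {G : topologicalZmodType} {X : topologicalType}.
Context (hausG : hausdorff_space G).
Context (mu : {measure set (borel G) -> \bar R}) (haar : haar_measure mu).
Context (hausX : hausdorff_space X) (lcX : locally_compact [set: X]).
Context (theta : continuous_action G X) (proper : proper_action theta).
Implicit Types (a b f : C0 R X).

Definition transporter (C D : set X) : set G := [set t | exists2 q, C q & D (theta t q)].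

(** It is the projection to [G] of the preimage of [D] times [C] under the proper map of the
    action. *)
Lemma transporter_compact (C D : set X) : compact C -> compact D ->
  compact (transporter C D).
Proof.
move=> cC cD; have -> : transporter C D =
    fst @` ((fun tp : G * X => (theta tp.1 tp.2, tp.2)) @^-1` (D `*` C)).
  apply/seteqP; split => [t [q Cq Dq]|_ [[t q] /= [Dq Cq] <-]]; last by exists q.
  by exists (t, q).
apply: continuous_compact; last exact/proper/compact_setX.
by apply: continuous_subspaceT => y; exact: cvg_fst.
Qed.

Lemma act_subK t p : theta t (theta (- t) p) = p.
Proof. by rewrite -actD subrr act0. Qed.

Section compactly_supported.
Context (f : C0 R X) (hf : compact_support f).
Let S := closure [set p | f p != 0].

Lemma notin_support p : ~ S p -> f p = 0.
Proof.
by move=> Sp; apply/eqP/negPn/negP => fp; apply: Sp; exact: subset_closure.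
Qed.

(* If the orbit map meets the support at t0, i.e. p = t0 q with q in S, then
   t |-> f(-t p) is supported in t0 + transporter S S, whose measure does not
   depend on p. *)
Lemma orbit_integral_bound M p : relatively_compact M ->
  \int[mu]_(t in M) rnorm (f (theta (- t) p)) <=
  rnorm f * fine (mu (transporter S S)).
Proof.
move=> rM; set T := transporter S S.
have rT : relatively_compact T by apply: compact_rc => //; exact: transporter_compact.
have B0 : 0 <= rnorm f * fine (mu T) by rewrite mulr_ge0 ?rnorm_ge0 ?fine_ge0.
have co := continuous_rnorm_comp (@orbit_fun_continuous _ _ _ theta f p).
have [[t0 Sp]|nS] := pselect (exists t, S (theta (- t) p)); last first.
  rewrite (@eq_Rintegral _ _ _ _ _ ((fun=> 0) : borel G -> R)).
    by rewrite Rintegral_cst ?mul0r//; case: rM.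
  move=> t _; rewrite notin_support ?rnorm0//.
  by move=> St; apply: nS; exists t.
pose T0 : set (borel G) := [set t | T ((t : G) - t0)].
have rT0 : relatively_compact T0 by exact: rc_shift.
have rMT := rc_setU rM rT0.
have rD := rc_setD rMT rT0.
(* Enlarging [M] by [T0] only increases the integral; the integrand vanishes off [T0], leaving an
   integral over a translate of [T]. *)
apply: (@le_trans _ _ (\int[mu]_(t in M `|` T0) rnorm (f (theta (- t) p)))).
  rewrite [leRHS](Rintegral_split haar rMT rM (@subsetUl _ _ _) co) lerDl.
  by apply: Rintegral_ge0 => t _; exact: rnorm_ge0.
rewrite (Rintegral_split haar rMT rT0 (@subsetUr _ _ _) co).
rewrite [X in _ + X](@eq_Rintegral _ _ _ _ _ ((fun=> 0) : borel G -> R)).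
  rewrite Rintegral_cst ?mul0r ?addr0//; last by case: rD.
  rewrite -(haar_shift haar (- t0)); last by case: rT.
  by apply: (Rintegral_le_measure haar rT0 co) => t _; exact: c0_rnorm_ub.
move=> t /set_mem[_ nT]; rewrite notin_support ?rnorm0// => St; apply: nT.
exists (theta (- t) p) => //.
by rewrite -actD addrAC subrr add0r.
Qed.

(** Off a compact [K] the factor [b] is small and [orbit_integral_bound] handles the rest. For [p]
    in [K], a nonzero integrand forces [t] into the compact set [transporter S K]. *)
Lemma compact_support_tails b :
  small_tails mu (fun t => mulC0 (alpha theta t f) b).
Proof.
move=> e e0; pose A := rnorm f * fine (mu (transporter S S)).
have A0 : 0 <= A by rewrite mulr_ge0 ?rnorm_ge0 ?fine_ge0.
have A1 : 0 < A + 1 by rewrite ltr_wpDl.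
have /vanishingP/(_ _ (divr_gt0 e0 A1))[K cK HK] := c0_valP b.
exists (transporter S K : set (borel G)).
  by apply: compact_rc => //; exact: transporter_compact.
move=> M rM MK p; have mM : measurable M by case: rM.
have co := continuous_rnorm_comp (@orbit_fun_continuous _ _ _ theta f p).
have ch : continuous (fun t => rnorm (mulC0 (alpha theta t f) b p) : R).
  exact/continuous_rnorm_comp/continuous_eval/mulC0_alpha_continuous.
have [Kp|/HK bp] := pselect (K p).
  rewrite (@eq_Rintegral _ _ _ _ _ ((fun=> 0) : borel G -> R)).
    by rewrite Rintegral_cst// mul0r ltW.
  move=> t /set_mem Mt; change (rnorm (f (theta (- t) p) * b p) = 0).
  rewrite notin_support ?mul0r ?rnorm0// => St.
  suff : (M `&` transporter S K) t by rewrite MK.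
  by split => //; exists (theta (- t) p) => //; rewrite act_subK.
apply: (@le_trans _ _ (\int[mu]_(t in M) (e / (A + 1) * rnorm (f (theta (- t) p))))).
  apply: (le_Rintegral_rc haar rM ch).
    by move=> t; apply: cvgM; [exact: cvg_cst|exact: co].
  move=> t _; rewrite [X in rnorm X]mulC0E rnormM mulrC ler_wpM2r ?rnorm_ge0//.
  exact: ltW.
rewrite RintegralZl//; last exact: rc_integrable.
rewrite mulrAC ler_pdivrMr// ler_wpM2l ?(ltW e0)//.
by rewrite (le_trans (orbit_integral_bound p rM))// lerDl.
Qed.

Lemma compact_support_alpha_integrable : alpha_integrable mu theta f.
Proof.
move=> b; have cb := @mulC0_alpha_continuous _ _ _ theta f b.
have ib := tails_unconditionally_integrable haar cb (compact_support_tails b).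
have bf : (fun t => mulC0 b (alpha theta t f)) = (fun t => mulC0 (alpha theta t f) b).
  apply/funext => t; apply: c0_ext => p.
  change (b p * f (theta (- t) p) = f (theta (- t) p) * b p).
  exact: mulrC.
by rewrite bf; split; exact: ib.
Qed.

Local Notation E := (fourier_coefficient mu theta).

Lemma fourier_coefficient_off_orbit x p :
  (forall t, ~ S (theta (- t) p)) -> E x f p = 0.
Proof.
move=> nS; apply: rnorm_eq_of_le => e e0.
have [b [b1 _]] := c0_bump (R := R) hausX lcX (@compact_set1 _ p).
have [K rK HK] := fourier_approx haar hausX lcX x b compact_support_alpha_integrable e0.
have := HK K rK (@subset_refl _ _) p (b1 p erefl).
rewrite /partial_coefficient [X in cint mu K X](_ : _ = (fun=> 0)).
  by rewrite cint_cst ?mulr0//; case: rK.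
by apply/funext => t; rewrite notin_support ?mulr0.
Qed.

Lemma compact_support_relatively_continuous g : alpha_integrable mu theta g ->
  relatively_continuous mu theta f g.
Proof.
move=> ig e e0; have jf := compact_support_alpha_integrable.
(* [hf] is read as compactness of [S], the set on which both coefficients are bounded and
   equicontinuous. *)
have [B B0 HB] := fourier_bounded_on_compact haar hausX lcX jf hf.
have [D D0 HD] := fourier_bounded_on_compact haar hausX lcX ig hf.
have eD : 0 < e / (4 * D) by rewrite divr_gt0// mulr_gt0.
have eB : 0 < e / (4 * B) by rewrite divr_gt0// mulr_gt0.
have nf := fourier_equicontinuous_on_compact haar hausX lcX jf hf eD.
have ng := fourier_equicontinuous_on_compact haar hausX lcX ig hf eB.
apply: filterS2 nf ng => z nf ng x y.
apply: (@le_lt_trans _ _ (e / 2)); last by lra.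
apply: supnorm_le => [|p]; first by lra.
change (rnorm (E (dualM x z) f p * E y g p - E x f p * E (dualM z y) g p) <= e / 2).
have [[t0 Sp]|nS] := pselect (exists t, S (theta (- t) p)); last first.
  have nS' t : ~ S (theta (- t) p) by move=> St; apply: nS; exists t.
  have vanish (u u' v v' : R[i]) : u = 0 -> u' = 0 -> rnorm (u * v - u' * v') <= e / 2.
    by move=> -> ->; rewrite !mul0r subrr rnorm0 ltW// divr_gt0.
  by apply: vanish; exact: fourier_coefficient_off_orbit.
(* Move along the orbit to a point [q] of [S]; equivariance makes both products pick up the same
   unimodular factor at [t0]. *)
rewrite -(act_subK t0 p); move: (theta (- t0) p) Sp => q Sq.
have act_eq (u u' v v' : R[i]) :
    u = pairing (dualM x z) t0 * E (dualM x z) f q ->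
    v = pairing y t0 * E y g q ->
    u' = pairing x t0 * E x f q ->
    v' = pairing (dualM z y) t0 * E (dualM z y) g q ->
    rnorm (u * v - u' * v') <= e / 2.
  move=> -> -> -> ->.
  have -> : e / 2 = e / (4 * D) * D + B * (e / (4 * B)).
    by field; rewrite !gt_eqF.
  apply: rnorm_twisted_cross_le; try exact: rnorm_pairing.
  - exact: nf.
  - exact: HD.
  - exact: HB.
  (* Equicontinuity perturbs the character on the right, whereas [z] stands on the left here. *)
  - by rewrite dualMC; exact: ng.
by apply: act_eq; exact: fourier_coefficient_act.
Qed.

End compactly_supported.

End main.

Theorem proposition12p3 (R : realType) (G : topologicalZmodType)
    (hausG : hausdorff_space G) (lcG : locally_compact [set: G])
    (mu : {measure set (borel G) -> \bar R}) (haar : haar_measure mu)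
    (X : topologicalType)
    (hausX : hausdorff_space X) (lcX : locally_compact [set: X])
    (theta : continuous_action G X) (proper : proper_action theta)
    (f : C0 R X) (hf : compact_support f) :
  absolutely_continuous mu theta f.
Proof.
split; first exact: compact_support_alpha_integrable.
by move=> g; exact: compact_support_relatively_continuous.
Qed.
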